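(* Consider the theory in the language $\{\times,{}^{-1},\mathbf 0,\mathbf 1,\boldsymbol\omega_2,\boldsymbol\omega_3,\boldsymbol\omega_4,\dots\}$ with the following axioms, where $n$ ranges over all natural numbers $n>1$: (M$_1$) $\forall x,y,z\,(x\cdot(y\cdot z)=(x\cdot y)\cdot z)$; (M$_2$) $\forall x\,(x\cdot\mathbf 1=x)$; (M$_3$) $\forall x\,(x\neq\mathbf 0\rightarrow x\cdot x^{-1}=\mathbf 1)$; (M$_4$) $\forall x,y\,(x\cdot y=y\cdot x)$; (M$_5$) $\forall x\,(x\cdot\mathbf 0=\mathbf 0=\mathbf 0^{-1})$; (M$_{6,n}$) $\bigwedge_{0\le i<j<n}(\boldsymbol\omega_n)^i\neq(\boldsymbol\omega_n)^j$; (M$_{7,n}$) $\forall x\,\bigl(x^n=\mathbf 1\leftrightarrow\bigvee_{0\le i<n}x=(\boldsymbol\omega_n)^i\bigr)$; (M$_{8,n}$) $\forall x\,\exists y\,(y^n=x)$. This theory completely axiomatizes the multiplicative theory of the complex numbers. Moreover, the structure $\langle\mathbb C;\times,{}^{-1},\mathbf 0,\mathbf 1,\boldsymbol\omega_2,\boldsymbol\omega_3,\boldsymbol\omega_4,\dots\rangle$ admits quantifier elimination, and so has a decidable theory.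
   Context: The multiplicative theory of a set of numbers closed under multiplication is the first-order theory of the structure consisting of that set with (solely) the multiplication operation; here it is the theory of $\langle\mathbb C;\times\rangle$. A theory $T$ completely axiomatizes it if, for every first-order sentence in the language $\{\times\}$, the sentence is true in $\langle\mathbb C;\times\rangle$ if and only if it is provable from $T$. The symbols $\times$ and $\cdot$ are used interchangeably. In $\mathbb C$, $\boldsymbol\omega_n$ is interpreted as $\cos(2\pi/n)+\mathrm i\sin(2\pi/n)$ for $n\ge 2$, ${}^{-1}$ is the multiplicative inverse on nonzero elements, and by convention $0^{-1}=0$. $x^n$ abbreviates $x\cdot x\cdots x$ ($n$ times), with $x^0=\mathbf 1$. A structure admits quantifier elimination if every formula of its language is equivalent in the structure to a quantifier-free formula of that language. A theory is decidable if there is an algorithm deciding whether a given sentence belongs to it. *)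

(* Defs.v *)
From Stdlib Require List.
From mathcomp Require Import all_boot all_order all_algebra.
From mathcomp Require Import reals trigo.
From mathcomp Require Export complex.

Set Implicit Arguments.
Unset Strict Implicit.
Unset Printing Implicit Defensive.

(** * Syntax

    Variables are de Bruijn indices: in [All p] index 0 is the bound variable
    and index [k.+1] is the variable [k] of the surrounding context. *)

(** [Omega k] is the constant symbol omega_(k+2), so that exactly the symbols
    omega_2, omega_3, ... are available; see [omega]. *)
Inductive term : Type :=
| Var of nat
| Mul of term & term
| Inv of term
| Zero
| One
| Omega of nat.

Inductive formula : Type :=
| Eq of term & term
| Bot
| Imp of formula & formula
| All of formula.

Definition Neg (p : formula) : formula := Imp p Bot.
Definition Top : formula := Neg Bot.
Definition Or (p q : formula) : formula := Imp (Neg p) q.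
Definition And (p q : formula) : formula := Neg (Imp p (Neg q)).
Definition Iff (p q : formula) : formula := And (Imp p q) (Imp q p).
Definition Ex (p : formula) : formula := Neg (All (Neg p)).

Definition Conj (s : seq formula) : formula := foldr And Top s.
Definition Disj (s : seq formula) : formula := foldr Or Bot s.

(** [Pow t n] is [t * (t * ... * t)] with [n] factors, and [One] if [n = 0]. *)
Definition Pow (t : term) (n : nat) : term := iterop n Mul t One.

(** Meaningful for [1 < n] only. *)
Definition omega (n : nat) : term := Omega (n - 2).

Fixpoint qfree (p : formula) : bool :=
  match p with
  | Eq _ _ | Bot => true
  | Imp p q => qfree p && qfree q
  | All _ => false
  end.

Fixpoint bounded_term (k : nat) (t : term) : bool :=
  match t with
  | Var n => n < k
  | Mul t u => bounded_term k t && bounded_term k u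
  | Inv t => bounded_term k t
  | Zero | One | Omega _ => true
  end.

Fixpoint bounded (k : nat) (p : formula) : bool :=
  match p with
  | Eq t u => bounded_term k t && bounded_term k u
  | Bot => true
  | Imp p q => bounded k p && bounded k q
  | All p => bounded k.+1 p
  end.

Definition sentence (p : formula) : bool := bounded 0 p.

(** Membership in the language whose only non-logical symbol is [Mul]. *)
Fixpoint mul_term (t : term) : bool :=
  match t with
  | Var _ => true
  | Mul t u => mul_term t && mul_term u
  | Inv _ | Zero | One | Omega _ => false
  end.

Fixpoint mul_formula (p : formula) : bool :=
  match p with
  | Eq t u => mul_term t && mul_term u
  | Bot => true
  | Imp p q => mul_formula p && mul_formula q
  | All p => mul_formula p
  end.

(** * Semantics *)

Record structure := Structure {
  carrier :> Type;
  smul : carrier -> carrier -> carrier;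
  sinv : carrier -> carrier;
  szero : carrier;
  sone : carrier;
  somega : nat -> carrier (* [somega n] interprets omega_n; used for 1 < n *)
}.

Definition scons (T : Type) (x : T) (s : nat -> T) (n : nat) : T :=
  if n is k.+1 then s k else x.

Fixpoint eval (M : structure) (e : nat -> M) (t : term) : M :=
  match t with
  | Var n => e n
  | Mul t u => smul (eval e t) (eval e u)
  | Inv t => sinv (eval e t)
  | Zero => szero M
  | One => sone M
  | Omega k => somega M k.+2
  end.

Fixpoint sat (M : structure) (e : nat -> M) (p : formula) : Prop :=
  match p with
  | Eq t u => eval e t = eval e u
  | Bot => False
  | Imp p q => sat e p -> sat e q
  | All p => forall x : M, sat (scons x e) p
  end.

Definition true_in (M : structure) (p : formula) : Prop :=
  forall e : nat -> M, sat e p.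

Definition admits_qe (M : structure) : Prop :=
  forall p : formula, exists2 q : formula,
    qfree q & forall e : nat -> M, sat e p <-> sat e q.

(** * Provability: classical natural deduction with equality *)

Fixpoint subst_term (s : nat -> term) (t : term) : term :=
  match t with
  | Var n => s n
  | Mul t u => Mul (subst_term s t) (subst_term s u)
  | Inv t => Inv (subst_term s t)
  | Zero => Zero
  | One => One
  | Omega k => Omega k
  end.

Definition shift (n : nat) : term := Var n.+1.

Definition up (s : nat -> term) : nat -> term :=
  scons (Var 0) (fun n => subst_term shift (s n)).

Fixpoint subst (s : nat -> term) (p : formula) : formula :=
  match p with
  | Eq t u => Eq (subst_term s t) (subst_term s u)
  | Bot => Bot
  | Imp p q => Imp (subst s p) (subst s q)
  | All p => All (subst (up s) p)
  end.

Definition inst (t : term) (p : formula) : formula := subst (scons t Var) p.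

Inductive derivable : seq formula -> formula -> Prop :=
| D_hyp G p : List.In p G -> derivable G p
| D_impI G p q : derivable (p :: G) q -> derivable G (Imp p q)
| D_impE G p q : derivable G (Imp p q) -> derivable G p -> derivable G q
| D_raa G p : derivable (Neg p :: G) Bot -> derivable G p
| D_allI G p : derivable (map (subst shift) G) p -> derivable G (All p)
| D_allE G p t : derivable G (All p) -> derivable G (inst t p)
| D_refl G t : derivable G (Eq t t)
| D_eqE G p t u :
    derivable G (Eq t u) -> derivable G (inst t p) -> derivable G (inst u p).

Definition provable (T : formula -> Prop) (p : formula) : Prop :=
  exists2 G : seq formula, (forall q, List.In q G -> T q) & derivable G p.

(** * The axioms *)

Inductive mult_axiom : formula -> Prop :=
| M1 : mult_axiom
    (All (All (All (Eq (Mul (Var 2) (Mul (Var 1) (Var 0)))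
                       (Mul (Mul (Var 2) (Var 1)) (Var 0))))))
| M2 : mult_axiom (All (Eq (Mul (Var 0) One) (Var 0)))
| M3 : mult_axiom
    (All (Imp (Neg (Eq (Var 0) Zero)) (Eq (Mul (Var 0) (Inv (Var 0))) One)))
| M4 : mult_axiom
    (All (All (Eq (Mul (Var 1) (Var 0)) (Mul (Var 0) (Var 1)))))
| M5 : mult_axiom
    (All (And (Eq (Mul (Var 0) Zero) Zero) (Eq Zero (Inv Zero))))
| M6 n : 1 < n -> mult_axiom
    (Conj [seq Neg (Eq (Pow (omega n) i) (Pow (omega n) j))
          | j <- iota 0 n, i <- iota 0 j])
| M7 n : 1 < n -> mult_axiom
    (All (Iff (Eq (Pow (Var 0) n) One)
              (Disj [seq Eq (Var 0) (Pow (omega n) i) | i <- iota 0 n])))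
| M8 n : 1 < n -> mult_axiom
    (All (Ex (Eq (Pow (Var 0) n) (Var 1)))).

(** [T] may use the whole language, but only the sentences in the language of
    multiplication alone are concerned (on these, truth in [M] is truth in the
    reduct of [M] to multiplication). *)
Definition completely_axiomatizes_mul
    (T : formula -> Prop) (M : structure) : Prop :=
  forall p : formula, sentence p -> mul_formula p ->
    (true_in M p <-> provable T p).

(** * Decidability: general recursive functions and Goedel numbering *)

(** Total functions nat^n -> nat, closed under primitive recursion (on the
    first argument) and minimization of functions that always have a zero. *)
Inductive recursive : forall n : nat, (n.-tuple nat -> nat) -> Prop :=
| Rec_zero : @recursive 0 (fun _ => 0)
| Rec_succ : @recursive 1 (fun v => (thead v).+1)
| Rec_proj n (i : 'I_n) : @recursive n (fun v => tnth v i)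
| Rec_comp n m (g : m.-tuple nat -> nat) (h : 'I_m -> n.-tuple nat -> nat) :
    recursive g -> (forall i, recursive (h i)) ->
    @recursive n (fun v => g [tuple h i v | i < m])
| Rec_prim n (g : n.-tuple nat -> nat) (h : n.+2.-tuple nat -> nat) :
    recursive g -> recursive h ->
    @recursive n.+1 (fun v =>
      let w := [tuple of behead v] in
      nat_rect (fun=> nat) (g w) (fun k r => h [tuple of k :: r :: w]) (thead v))
| Rec_min n (g : n.+1.-tuple nat -> nat) (f : n.-tuple nat -> nat) :
    recursive g ->
    (forall v, g [tuple of f v :: v] = 0 /\
               forall k, k < f v -> g [tuple of k :: v] <> 0) ->
    recursive f
| Rec_ext n (f g : n.-tuple nat -> nat) :
    f =1 g -> recursive f -> recursive g.

(** Cantor's pairing function. *)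
Definition npair (x y : nat) : nat := ((x + y) * (x + y).+1)./2 + y.

Fixpoint code_term (t : term) : nat :=
  match t with
  | Var n => npair 0 n
  | Mul t u => npair 1 (npair (code_term t) (code_term u))
  | Inv t => npair 2 (code_term t)
  | Zero => npair 3 0
  | One => npair 4 0
  | Omega k => npair 5 k
  end.

Fixpoint code (p : formula) : nat :=
  match p with
  | Eq t u => npair 0 (npair (code_term t) (code_term u))
  | Bot => npair 1 0
  | Imp p q => npair 2 (npair (code p) (code q))
  | All p => npair 3 (code p)
  end.

Definition decidable_theory (M : structure) : Prop :=
  exists2 f : 1.-tuple nat -> nat, recursive f &
    forall p : formula, sentence p ->
      (true_in M p <-> f [tuple code p] = 1).

(** * The complex numbers *)

Local Open Scope ring_scope.
Local Open Scope complex_scope.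

Definition complex_omega (R : realType) (n : nat) : R[i] :=
  cos (2 * pi / n%:R) +i* sin (2 * pi / n%:R).

(** The inverse of the field [R[i]] satisfies [0^-1 = 0]. *)
Definition complex_structure (R : realType) : structure :=
  @Structure R[i] (fun x y => x * y) (fun x => x^-1) 0 1 (@complex_omega R).

(* Main.v *)
Require Import Defs.
From Stdlib Require List.
From Stdlib Require Import Setoid.
From HB Require Import structures.
From mathcomp Require Import all_boot all_order all_algebra reals trigo.
From mathcomp Require Import boolp zify ring lra.

Set Implicit Arguments.
Unset Strict Implicit.
Unset Printing Implicit Defensive.

(** The nonzero elements of a model of the axioms form a divisible abelian group,
    whose elements of order dividing [n] are the powers of omega_n. What a
    formula can express about a tuple [a] of elements is limited: a formula with
    [d] quantifiers and terms of size [N] only sees which entries are zero and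
    which equations [a^m = zeta] hold, where the exponents in [m] are bounded by a
    number [level N d] and [zeta] is a power of omega_L for one [L] that is
    divisible by all small numbers. This is proved by a back-and-forth argument
    ([alike_sat_in]). Its core is the extension step [extend]: if [a] and [b] agree
    on the equations up to a large bound and [g] is an element next to [a], take
    the least [n > 0] for which [g^n] is a small monomial in [a] times a power of
    omega_L. If there is none, answer with an element satisfying no small equation
    over [b], and otherwise with an [n]-th root of the same monomial in [b]. All
    small equations for [g] are consequences of that minimal one, and the same
    holds for the answer, because a shorter equation for it could be pulled back to
    [g] at the cost of a root of unity of small order ([small_relation_back]).

    The argument only takes roots of bounded degree and only uses that not all
    elements satisfy some small equation. It therefore also applies to a finite
    board, the cyclic group of order [F ^ d.+1] with a zero adjoined, if the
    quantifier followed by at most [j] others ranges over zero and the multiples of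
    [F ^ j] in additive notation; here [F] is a factorial. So the truth of a
    sentence in a model is its truth on a finite board that depends on the sentence
    only ([model_board]).

    All three claims follow. The axioms do not decide how, for instance, omega_6
    and omega_3 are related, but a sentence about multiplication does not mention
    these constants; if it is true in the complex numbers, then it is true in every
    model and hence provable by Goedel's theorem ([completeness]). Tuples of complex
    numbers that agree on the finitely many bounded equations satisfy the same
    formulas, so that every formula is a boolean combination of such equations
    ([model_qe]). Finally, truth on the finite board is computed by recursion on the
    code of the sentence ([decideP]), and the computation is shown to be recursive
    by storing all earlier values as the digits of one number ([prf_table]). *)



(** * Substitution and soundness *)

Lemma eval_subst (M : structure) (e : nat -> M) s t :
  eval e (subst_term s t) = eval (fun n => eval e (s n)) t.
Proof. by elim: t => //= [t -> u ->|t ->]. Qed.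

Lemma eval_up (M : structure) (e : nat -> M) x s :
  (fun n => eval (scons x e) (up s n)) = scons x (fun n => eval e (s n)).
Proof. by apply: funext => -[|n] //=; rewrite eval_subst. Qed.

Lemma sat_subst (M : structure) p (e : nat -> M) s :
  sat e (subst s p) <-> sat (fun n => eval e (s n)) p.
Proof.
elim: p e s => [t u||p IHp q IHq|p IHp] e s //=.
- by rewrite !eval_subst.
- by rewrite IHp IHq.
- by split=> H x; [move: (H x) => /IHp|apply/IHp; move: (H x)]; rewrite eval_up.
Qed.

Lemma sat_inst (M : structure) p (e : nat -> M) t :
  sat e (inst t p) <-> sat (scons (eval e t) e) p.
Proof.
have -> : scons (eval e t) e = (fun n => eval e (scons t Var n)).
  by apply: funext => -[].
exact: sat_subst.
Qed.

Lemma sat_shift (M : structure) p (e : nat -> M) x :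
  sat (scons x e) (subst shift p) <-> sat e p.
Proof. by rewrite sat_subst. Qed.

Lemma eval_bounded (M : structure) (e e' : nat -> M) k t :
  bounded_term k t -> (forall i, i < k -> e i = e' i) -> eval e t = eval e' t.
Proof.
move=> + ee'; elim: t => //= [t IHt u IHu /andP[/IHt -> /IHu ->] //|t IHt].
by move=> /IHt ->.
Qed.

Lemma sat_bounded (M : structure) p k (e e' : nat -> M) :
  bounded k p -> (forall i, i < k -> e i = e' i) -> sat e p <-> sat e' p.
Proof.
elim: p k e e' => [t u||p IHp q IHq|p IHp] k e e' //=.
- by case/andP=> bt bu ee'; rewrite (eval_bounded bt ee') (eval_bounded bu ee').
- by case/andP=> bp bq ee'; rewrite (IHp k e e') // (IHq k e e').
- move=> bp ee'.
  by split=> H x; move: (H x); rewrite (IHp k.+1 (scons x e) (scons x e')) //;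
    move=> [|i] //=; rewrite ltnS; move=> ik; rewrite ee'.
Qed.

Lemma In_map (A B : Type) (f : A -> B) s y :
  List.In y (map f s) -> exists2 x, List.In x s & y = f x.
Proof.
elim: s => //= x s IHs [<-|/IHs[z zs ->]]; first by exists x; [left|].
by exists z; [right|].
Qed.

Lemma In_map_f (A B : Type) (f : A -> B) s x :
  List.In x s -> List.In (f x) (map f s).
Proof. by elim: s => //= y s IHs [->|/IHs]; [left|right]. Qed.

Lemma soundness (M : structure) G p : derivable G p ->
  forall e : nat -> M, (forall q, List.In q G -> sat e q) -> sat e p.
Proof.
elim=> {G p} [G p Gp|G p q _ IH|G p q _ IH1 _ IH2|G p _ IH|G p _ IH|G p t _ IH
             |G t|G p t u _ IH1 _ IH2] e He //=.
- exact: He.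
- by move=> Hp; apply: (IH e) => r /= [<- //|rG]; apply: He.
- by apply: (IH1 e He); apply: IH2.
- by apply: contrapT => nHp; apply: (IH e) => r /= [<- //|rG]; apply: He.
- move=> x; apply: (IH (scons x e)) => r rG.
  by have [q qG ->] := In_map rG; apply/sat_shift; apply: (He q).
- by apply/sat_inst; apply: (IH e He).
- by apply/sat_inst; rewrite -(IH1 e He); apply/sat_inst; apply: (IH2 e He).
Qed.

Definition models (T : formula -> Prop) (M : structure) : Prop :=
  forall q, T q -> true_in M q.

Lemma provable_true T (M : structure) p :
  models T M -> provable T p -> true_in M p.
Proof. by move=> TM [G GT Gp] e; apply: (soundness Gp) => q /GT Tq; apply: TM. Qed.

(** * The completeness theorem *)

Lemma subst_term_comp s s' t :
  subst_term s (subst_term s' t) = subst_term (fun n => subst_term s (s' n)) t.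
Proof. by elim: t => //= [t -> u ->|t ->]. Qed.

Lemma up_comp s s' :
  (fun n => subst_term (up s) (up s' n)) = up (fun n => subst_term s (s' n)).
Proof. by apply: funext => -[|n] //=; rewrite !subst_term_comp. Qed.

Lemma subst_comp s s' p :
  subst s (subst s' p) = subst (fun n => subst_term s (s' n)) p.
Proof.
elim: p s s' => //= [t u|p IHp q IHq|p IHp] s s'.
- by rewrite !subst_term_comp.
- by rewrite IHp IHq.
- by rewrite IHp up_comp.
Qed.

Lemma subst_term_bounded k s s' t : bounded_term k t ->
  (forall i, i < k -> s i = s' i) -> subst_term s t = subst_term s' t.
Proof.
move=> + ss'; elim: t => //= [t IHt u IHu /andP[/IHt -> /IHu ->] //|t IHt].
by move=> /IHt ->.
Qed.

Lemma subst_bounded k s s' p : bounded k p ->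
  (forall i, i < k -> s i = s' i) -> subst s p = subst s' p.
Proof.
elim: p k s s' => //= [t u|p IHp q IHq|p IHp] k s s'.
- by case/andP=> bt bu ss'; rewrite !(subst_term_bounded _ ss').
- by case/andP=> bp bq ss'; rewrite (IHp k s s') // (IHq k s s').
- move=> bp ss'; rewrite (IHp _ _ (up s') bp) // => -[|i] //=.
  by rewrite ltnS; move=> ik; rewrite ss'.
Qed.

Lemma subst_term_id t : subst_term Var t = t.
Proof. by elim: t => //= [t -> u ->|t ->]. Qed.

Lemma subst_id p : subst Var p = p.
Proof.
have upV : up Var = Var by apply: funext => -[].
by elim: p => //= [t u|p -> q ->|p IHp] //; rewrite ?subst_term_id ?upV ?IHp.
Qed.

Lemma subst_inst s t p :
  subst s (inst t p) = inst (subst_term s t) (subst (up s) p).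
Proof.
rewrite /inst !subst_comp; congr subst; apply: funext => -[|n] //=.
by rewrite subst_term_comp /= -[LHS]subst_term_id.
Qed.

Lemma subst_scons s t p : subst (scons t s) p = inst t (subst (up s) p).
Proof.
rewrite /inst subst_comp; congr subst; apply: funext => -[|n] //=.
by rewrite subst_term_comp /= -[LHS]subst_term_id.
Qed.

Lemma derivable_weaken G G' p : derivable G p ->
  (forall q, List.In q G -> List.In q G') -> derivable G' p.
Proof.
move=> d; elim: d G' => {G p} [G p Gp|G p q _ IH|G p q _ IH1 _ IH2|G p _ IH|G p _ IH
                   |G p t _ IH|G t|G p t u _ IH1 _ IH2] G' GG'.
- by apply: D_hyp; apply: GG'.
- by apply: D_impI; apply: IH => r /= [->|qG]; [left|right; apply: GG'].
- exact: D_impE (IH1 _ GG') (IH2 _ GG').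
- by apply: D_raa; apply: IH => r /= [->|qG]; [left|right; apply: GG'].
- apply: D_allI; apply: IH => r rG.
  by have [q /GG' qG ->] := In_map rG; apply: In_map_f.
- exact: D_allE (IH _ GG').
- exact: D_refl.
- exact: D_eqE (IH1 _ GG') (IH2 _ GG').
Qed.

Lemma derivable_subst G p s :
  derivable G p -> derivable (map (subst s) G) (subst s p).
Proof.
move=> d; elim: d s => {G p} [G p Gp|G p q _ IH|G p q _ IH1 _ IH2|G p _ IH|G p _ IH
                   |G p t _ IH|G t|G p t u _ IH1 _ IH2] s /=.
- by apply: D_hyp; apply: In_map_f.
- by apply: D_impI; apply: IH.
- exact: D_impE (IH1 _) (IH2 _).
- by apply: D_raa; apply: IH.
- apply: D_allI; move: (IH (up s)); rewrite -!map_comp.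
  congr (derivable _ _); apply: eq_map => q /=; rewrite !subst_comp.
  by congr subst.
- by rewrite subst_inst; apply: D_allE; apply: IH.
- exact: D_refl.
- rewrite subst_inst; apply: D_eqE (IH1 _) _.
  by rewrite -subst_inst.
Qed.

(** Rename [x] to the variable bound by the new quantifier and shift all the
    others; this turns the hypotheses into the shifted ones because [x] does not
    occur in them. *)
Lemma derivable_fresh x G p :
  (forall q, List.In q G -> bounded x q) -> bounded x p ->
  derivable G (inst (Var x) p) -> derivable G (All p).
Proof.
move=> bG bp /(derivable_subst (fun i => if i == x then Var 0 else shift i)) d.
apply: D_allI; have xP i : i < x -> (i == x) = false by case: ltngtP.
have -> : p = subst (fun i => if i == x then Var 0 else shift i) (inst (Var x) p).
  rewrite /inst subst_comp -[LHS]subst_id.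
  apply: (subst_bounded bp) => -[|i] /= ix; first by rewrite eqxx.
  by rewrite xP // ltnW.
apply: (derivable_weaken d) => q qG; have [r rG ->] := In_map qG.
rewrite (subst_bounded (bG r rG) (s' := shift)); first exact: In_map_f.
by move=> i ix; rewrite xP.
Qed.

Lemma bounded_term_leq k k' t : k <= k' -> bounded_term k t -> bounded_term k' t.
Proof.
move=> kk'; elim: t => //= [n /leq_trans|t IHt u IHu /andP[/IHt -> /IHu ->] //].
exact.
Qed.

Lemma bounded_leq k k' p : k <= k' -> bounded k p -> bounded k' p.
Proof.
elim: p k k' => [t u||p IHp q IHq|p IHp] k k' kk' //=.
- by case/andP=> /(bounded_term_leq kk') -> /(bounded_term_leq kk') ->.
- by case/andP=> /(IHp _ _ kk') -> /(IHq _ _ kk') ->.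
- exact: IHp.
Qed.

Fixpoint tbound (t : term) : nat :=
  match t with
  | Var n => n.+1
  | Mul t u => maxn (tbound t) (tbound u)
  | Inv t => tbound t
  | Zero | One | Omega _ => 0
  end.

Fixpoint fbound (p : formula) : nat :=
  match p with
  | Eq t u => maxn (tbound t) (tbound u)
  | Bot => 0
  | Imp p q => maxn (fbound p) (fbound q)
  | All p => (fbound p).-1
  end.

Lemma bounded_tbound k t : tbound t <= k -> bounded_term k t.
Proof. by elim: t => //= t IHt u IHu; rewrite geq_max => /andP[/IHt -> /IHu ->]. Qed.

Lemma bounded_fbound k p : fbound p <= k -> bounded k p.
Proof.
elim: p k => [t u||p IHp q IHq|p IHp] k //=.
- by rewrite geq_max => /andP[? ?]; rewrite !bounded_tbound.
- by rewrite geq_max => /andP[? ?]; rewrite IHp ?IHq.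
- by move=> pk; apply: IHp; case: (fbound p) pk.
Qed.

(** Bounds are exclusive, so that a common bound of the formulas is itself a
    variable that occurs in none of them. *)
Definition fresh (l : seq formula) : nat := foldr (fun p => maxn (fbound p)) 0 l.

Lemma bounded_fresh l q : List.In q l -> bounded (fresh l) q.
Proof.
move=> ql; apply: bounded_fbound; elim: l ql => //= p l IHl [->|/IHl le_ql].
  exact: leq_maxl.
exact: leq_trans le_ql (leq_maxr _ _).
Qed.

Definition tri (n : nat) : nat := (n * n.+1)./2.

Lemma triS n : tri n.+1 = tri n + n.+1.
Proof.
rewrite /tri; have -> : n.+1 * n.+2 = n * n.+1 + n.+1.*2.
  by rewrite -muln2 [n * _]mulnC -mulnDr addn2.
by rewrite halfD odd_double andbF add0n doubleK.
Qed.

Lemma leq_tri m n : m <= n -> tri m <= tri n.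
Proof. by move=> mn; rewrite half_leq // leq_mul. Qed.

Lemma npair_inj x y x' y' : npair x y = npair x' y' -> x = x' /\ y = y'.
Proof.
have key a b c d : a + b < c + d -> npair a b < npair c d.
  move=> lt_abcd; rewrite /npair -/(tri _) -/(tri _).
  apply: leq_trans (leq_addr d _); apply: leq_trans (leq_tri lt_abcd).
  by rewrite triS ltn_add2l ltnS leq_addl.
move=> e; have exy : x + y = x' + y'.
  by apply/eqP; case: ltngtP => // /key; rewrite e ltnn.
have ey : y = y' by move: e; rewrite /npair exy => /addnI.
by split=> //; move: exy; rewrite ey => /addIn.
Qed.

Lemma code_term_inj : injective code_term.
Proof.
elim=> [n|t IHt u IHu|t IHt|||n] [m|t' u'|t'|||m] //= /npair_inj[] //= _.
- by move=> ->.
- by case/npair_inj => /IHt -> /IHu ->.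
- by move/IHt ->.
- by move=> ->.
Qed.

Lemma code_inj : injective code.
Proof.
elim=> [t u||p IHp q IHq|p IHp] [t' u'||p' q'|p'] //= /npair_inj[] //= _.
- by case/npair_inj => /code_term_inj -> /code_term_inj ->.
- by case/npair_inj => /IHp -> /IHq ->.
- by move/IHp ->.
Qed.

Definition enum_formula (n : nat) : formula :=
  if pselect (exists p, code p = n) is left h then projT1 (cid h) else Bot.

Lemma enum_formulaK p : enum_formula (code p) = p.
Proof.
rewrite /enum_formula; case: pselect => [h|[]]; last by exists p.
by apply: code_inj; apply: (projT2 (cid h)).
Qed.

Section Henkin.

Variable T : formula -> Prop.
Hypothesis closedT : forall q, T q -> sentence q.

Definition proves (l : seq formula) (p : formula) : Prop :=
  provable (fun q => T q \/ List.In q l) p.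

Lemma proves_hyp l p : List.In p l -> proves l p.
Proof.
move=> pl; exists [:: p]; last by apply: D_hyp; left.
by move=> q [<-|//]; right.
Qed.

Lemma proves_axiom l p : T p -> proves l p.
Proof.
move=> Tp; exists [:: p]; last by apply: D_hyp; left.
by move=> q [<-|//]; left.
Qed.

Lemma proves_weaken l l' p :
  (forall q, List.In q l -> List.In q l') -> proves l p -> proves l' p.
Proof.
by move=> ll' [G Gl Gp]; exists G => // q /Gl[Tq|/ll' ql]; [left|right].
Qed.

Lemma proves_mp l p q : proves l (Imp p q) -> proves l p -> proves l q.
Proof.
move=> [G Gl Gpq] [G' G'l G'p]; exists (G ++ G').
  by move=> r; rewrite (List.in_app_iff G G' r) => -[/Gl|/G'l].
apply: (@D_impE _ p).
  by apply: (derivable_weaken Gpq) => r rG; apply/List.in_app_iff; left.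
by apply: (derivable_weaken G'p) => r rG; apply/List.in_app_iff; right.
Qed.

Lemma proves_eqE l p t u :
  proves l (Eq t u) -> proves l (inst t p) -> proves l (inst u p).
Proof.
move=> [G Gl Gpq] [G' G'l G'p]; exists (G ++ G').
  by move=> r; rewrite (List.in_app_iff G G' r) => -[/Gl|/G'l].
apply: (@D_eqE _ p t).
  by apply: (derivable_weaken Gpq) => r rG; apply/List.in_app_iff; left.
by apply: (derivable_weaken G'p) => r rG; apply/List.in_app_iff; right.
Qed.

(** The deduction theorem for [proves]: the finitely many hypotheses used by a
    derivation may contain [a] several times or be axioms, and are sorted
    classically. *)
Lemma proves_split l a p : proves (a :: l) p ->
  exists2 G, (forall q, List.In q G -> T q \/ List.In q l) & derivable (a :: G) p.
Proof.
move=> [G Gl Gp]; exists [seq q <- G | `[< T q \/ List.In q l >]].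
  by move=> q /List.filter_In[_ /asboolP].
apply: (derivable_weaken Gp) => q qG /=.
have [Tq|[->|ql]] := Gl _ qG; [right|by left|right];
  apply/List.filter_In; split=> //; apply/asboolP; [by left|by right].
Qed.

Lemma proves_impI l p q : proves (p :: l) q -> proves l (Imp p q).
Proof. by case/proves_split => G Gl Gq; exists G => //; apply: D_impI. Qed.

Lemma proves_raa l p : proves (Neg p :: l) Bot -> proves l p.
Proof. by case/proves_split => G Gl Gq; exists G => //; apply: D_raa. Qed.

Lemma proves_refl l t : proves l (Eq t t).
Proof. by exists [::] => //; apply: D_refl. Qed.

Lemma proves_allE l p t : proves l (All p) -> proves l (inst t p).
Proof. by move=> [G Gl Gp]; exists G => //; apply: D_allE. Qed.

Lemma proves_fresh l x p : (forall q, List.In q l -> bounded x q) ->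
  bounded x p -> proves l (inst (Var x) p) -> proves l (All p).
Proof.
move=> lx px [G Gl Gp]; exists G => //; apply: (derivable_fresh (x := x)) => //.
by move=> q /Gl[/closedT|/lx //]; apply: bounded_leq.
Qed.

Lemma proves_cut l p : proves (Neg p :: l) Bot -> proves (p :: l) Bot ->
  proves l Bot.
Proof. by move=> /proves_raa lp /proves_impI lnp; apply: proves_mp lnp lp. Qed.

(** One step towards a maximal consistent theory. Adding a counterexample along
    with the negation of a universal formula makes the limit a Henkin theory. At
    every stage only finitely many formulas are added to the sentences of [T], so
    that a fresh variable can serve as the counterexample. *)
Definition henkin_step (l : seq formula) (p : formula) : seq formula :=
  if `[< proves (p :: l) Bot >] then
    if p is All q then Neg (inst (Var (fresh (q :: p :: l))) q) :: Neg p :: l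
    else Neg p :: l
  else p :: l.

Lemma henkin_step_sub l p q : List.In q l -> List.In q (henkin_step l p).
Proof.
rewrite /henkin_step; case: asboolP => _; last by right.
by case: p => *; do ?right.
Qed.

Lemma henkin_step_consistent l p :
  ~ proves l Bot -> ~ proves (henkin_step l p) Bot.
Proof.
rewrite /henkin_step; case: asboolP => // lp nl.
have nlp : ~ proves (Neg p :: l) Bot by move=> lnp; apply: nl; apply: proves_cut lp.
case: p nlp lp => // q nlp lp /proves_raa lq; apply: nlp.
apply: (proves_mp (p := All q)); first by apply: proves_hyp; left.
apply: proves_fresh lq => [r [<-|rl]|].
- rewrite /= andbT; apply: (@bounded_fresh (q :: All q :: l) (All q)).
  by right; left.
- by apply: bounded_fresh; right; right.
- by apply: bounded_fresh; left.
Qed.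

Variable l0 : seq formula.
Hypothesis l0_consistent : ~ proves l0 Bot.

Fixpoint henkin_stage (n : nat) : seq formula :=
  if n is m.+1 then henkin_step (henkin_stage m) (enum_formula m) else l0.

Lemma henkin_stage_code p :
  henkin_stage (code p).+1 = henkin_step (henkin_stage (code p)) p.
Proof. by rewrite -{3}(enum_formulaK p). Qed.

Definition henkin_theory (p : formula) : Prop :=
  exists n, proves (henkin_stage n) p.

Local Notation Omega := henkin_theory.

Lemma henkin_stage_consistent n : ~ proves (henkin_stage n) Bot.
Proof. by elim: n => //= n; apply: henkin_step_consistent. Qed.

Lemma henkin_stage_sub m n p :
  m <= n -> proves (henkin_stage m) p -> proves (henkin_stage n) p.
Proof.
move=> /subnK <-; elim: (n - m) => //= k IHk /IHk; apply: proves_weaken => q.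
exact: henkin_step_sub.
Qed.

Lemma henkin_rule2 p q r :
  (forall l, proves l p -> proves l q -> proves l r) ->
  Omega p -> Omega q -> Omega r.
Proof.
move=> pqr [m mp] [n nq]; exists (maxn m n); apply: pqr.
  exact: henkin_stage_sub (leq_maxl _ _) mp.
exact: henkin_stage_sub (leq_maxr _ _) nq.
Qed.

Lemma henkin_rule1 p r : (forall l, proves l p -> proves l r) -> Omega p -> Omega r.
Proof. by move=> pr [n /pr]; exists n. Qed.

Lemma henkin_rule0 r : (forall l, proves l r) -> Omega r.
Proof. by exists 0. Qed.

Lemma henkin_mp p q : Omega (Imp p q) -> Omega p -> Omega q.
Proof. by apply: henkin_rule2 => l; apply: proves_mp. Qed.

Lemma henkin_consistent p : Omega p -> Omega (Neg p) -> False.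
Proof.
move=> Op Onp; have [n] := henkin_mp Onp Op; exact: henkin_stage_consistent.
Qed.

Lemma henkin_complete p : ~ Omega p -> Omega (Neg p).
Proof.
move=> nOp; exists (code p).+1; rewrite henkin_stage_code /henkin_step.
case: asboolP => lp.
  by apply: proves_hyp; case: (p) => *; do ?[by left | right].
by case: nOp; exists (code p).+1; rewrite henkin_stage_code /henkin_step;
  case: asboolP => // _; apply: proves_hyp; left.
Qed.

Lemma henkin_imp p q : Omega (Imp p q) <-> (Omega p -> Omega q).
Proof.
split=> [Opq Op|Opq]; first exact: henkin_mp Opq Op.
have [/Opq|nOp] := pselect (Omega p).
  apply: henkin_rule1 => l lq; apply: proves_impI.
  by apply: proves_weaken lq => r; right.
have := henkin_complete nOp; apply: henkin_rule1 => l lnp; apply: proves_impI.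
apply: proves_raa; apply: (proves_mp (p := p)).
  by apply: proves_weaken lnp => r; do 2 right.
by apply: proves_hyp; right; left.
Qed.

Lemma henkin_all p : Omega (All p) <-> (forall t, Omega (inst t p)).
Proof.
split=> [Op t|Op]; first by move: Op; apply: henkin_rule1 => l; apply: proves_allE.
apply: contrapT => nOp.
have lp : proves (All p :: henkin_stage (code (All p))) Bot.
  apply: contrapT => nlp; apply: nOp; exists (code (All p)).+1.
  rewrite henkin_stage_code /henkin_step.
  by case: asboolP => // _; apply: proves_hyp; left.
have [x Onx] : exists x, Omega (Neg (inst (Var x) p)).
  eexists; exists (code (All p)).+1.
  rewrite henkin_stage_code /henkin_step.
  by case: asboolP => // _; apply: proves_hyp; left.
exact: henkin_consistent (Op (Var x)) Onx.
Qed.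

Lemma henkin_eqE p t u : Omega (Eq t u) -> Omega (inst t p) -> Omega (inst u p).
Proof. by apply: henkin_rule2 => l; apply: proves_eqE. Qed.

Lemma henkin_refl t : Omega (Eq t t).
Proof. by apply: henkin_rule0 => l; apply: proves_refl. Qed.

Lemma inst_shift t u : subst_term (scons t Var) (subst_term shift u) = u.
Proof. by rewrite subst_term_comp /= -[RHS]subst_term_id. Qed.

Lemma henkin_congr (f : term -> term) (F : term) t u :
  (forall v, subst_term (scons v Var) F = f v) ->
  Omega (Eq t u) -> Omega (Eq (f t) (f u)).
Proof.
move=> Ff tu; rewrite -[f t](inst_shift u) -[f u]Ff.
have := @henkin_eqE (Eq (subst_term shift (f t)) F) t u tu.
rewrite /inst /= !inst_shift !Ff; apply; exact: henkin_refl.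
Qed.

Lemma henkin_sym t u : Omega (Eq t u) -> Omega (Eq u t).
Proof.
move=> tu; have := @henkin_eqE (Eq (Var 0) (subst_term shift t)) t u tu.
rewrite /inst /= !inst_shift; apply; exact: henkin_refl.
Qed.

Lemma henkin_trans t u v : Omega (Eq t u) -> Omega (Eq u v) -> Omega (Eq t v).
Proof.
move=> tu uv; have := @henkin_eqE (Eq (subst_term shift t) (Var 0)) u v uv.
by rewrite /inst /= !inst_shift; apply.
Qed.

Lemma henkin_inv t u : Omega (Eq t u) -> Omega (Eq (Inv t) (Inv u)).
Proof. by apply: (@henkin_congr Inv (Inv (Var 0))). Qed.

Lemma henkin_mul t t' u u' : Omega (Eq t t') -> Omega (Eq u u') ->
  Omega (Eq (Mul t u) (Mul t' u')).
Proof.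
move=> tt' uu'; apply: (@henkin_trans _ (Mul t' u)).
  apply: (@henkin_congr (Mul^~ u) (Mul (Var 0) (subst_term shift u))) tt' => v.
  by rewrite /= inst_shift.
apply: (@henkin_congr (Mul t') (Mul (subst_term shift t') (Var 0))) uu' => v.
by rewrite /= inst_shift.
Qed.

(** Terms modulo provable equality. A class is represented by the predicate of
    its members, which makes equality of classes an instance of extensionality. *)
Definition tclass : Type :=
  {c : term -> Prop | exists t, c = (fun u => Omega (Eq t u))}.

Definition cls (t : term) : tclass :=
  exist _ (fun u => Omega (Eq t u)) (ex_intro _ t erefl).

Definition repr (c : tclass) : term := projT1 (cid (projT2 c)).

Lemma cls_eq t u : cls t = cls u <-> Omega (Eq t u).
Proof.
split=> [/(congr1 (@proj1_sig _ _)) /= e|tu].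
  by rewrite (congr1 (@^~ u) e); apply: henkin_refl.
apply: eq_exist => /=; apply: funext => v; apply: propext; split.
  by apply: henkin_trans; apply: henkin_sym.
exact: henkin_trans.
Qed.

Lemma reprK c : cls (repr c) = c.
Proof.
by case: c => c cP; apply: eq_exist => /=; rewrite /repr /=; case: cid.
Qed.

Lemma repr_cls t : Omega (Eq (repr (cls t)) t).
Proof. by apply/cls_eq; rewrite reprK. Qed.

Definition term_model : structure :=
  @Structure tclass (fun c d => cls (Mul (repr c) (repr d)))
    (fun c => cls (Inv (repr c))) (cls Zero) (cls One)
    (fun n => cls (omega n)).

Lemma eval_term_model s t :
  eval (M := term_model) (fun n => cls (s n)) t = cls (subst_term s t).
Proof.
elim: t => //= [t -> u ->|t ->|k].
- by apply/cls_eq; apply: henkin_mul; apply: repr_cls.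
- by apply/cls_eq; apply: henkin_inv; apply: repr_cls.
- by rewrite /omega subn2.
Qed.

Lemma sat_term_model p s :
  sat (M := term_model) (fun n => cls (s n)) p <-> Omega (subst s p).
Proof.
elim: p s => /= [t u||p IHp q IHq|p IHp] s.
- by rewrite !eval_term_model; apply: cls_eq.
- by split=> // -[n] /henkin_stage_consistent.
- by rewrite IHp IHq henkin_imp.
- rewrite henkin_all.
  have scE t : scons (cls t) (fun n => cls (s n)) = (fun n => cls (scons t s n)).
    by apply: funext => -[].
  split=> [Hp t|Hp c].
    by rewrite -subst_scons; apply/IHp; rewrite -scE; apply: Hp.
  by rewrite -(reprK c) scE; apply/IHp; rewrite subst_scons.
Qed.

End Henkin.

(** Goedel's completeness theorem. If [p] were not provable, its negation would be
    consistent, and the term model of a Henkin theory containing the negation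
    would be a model of [T] in which [p] fails. *)
Theorem completeness T p : (forall q, T q -> sentence q) -> sentence p ->
  (forall M : structure, models T M -> true_in M p) -> provable T p.
Proof.
move=> closedT sp Tp; apply: contrapT => nTp.
have cons : ~ proves T [:: Neg p] Bot.
  by move=> /proves_raa[G GT Gp]; apply: nTp; exists G => // q /GT[].
pose M := term_model T [:: Neg p].
have satM q : sentence q -> henkin_theory T [:: Neg p] q <-> true_in M q.
  move=> sq; have := sat_term_model closedT cons q Var; rewrite subst_id => <-.
  have satE (e e' : nat -> M) : sat e q -> sat e' q.
    by have [] := @sat_bounded M q 0 e e' sq.
  by split=> [Mq e|]; [apply: satE Mq|apply].
have /Tp/(satM _ sp) Op : models T M.
  move=> q Tq; apply/satM; first exact: closedT.
  by exists 0; apply: proves_axiom.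
apply: (henkin_consistent closedT cons Op).
by exists 0; apply: proves_hyp; left.
Qed.

Import Order.TTheory GRing.Theory Num.Theory.
Local Open Scope ring_scope.

(** * Divisible groups with a zero adjoined *)

Section GroupStructure.

Variable G : zmodType.

(** The multiplicative structure on an additively written group with an
    absorbing element [None]; [w] plays the role of omega_L, which determines
    omega_n for the divisors [n] of [L]. *)
Definition gstruct (w : G) (L : nat) : structure :=
  @Structure (option G)
    (fun x y => if x is Some a then if y is Some b then Some (a + b) else None
                else None)
    (omap -%R) None (Some 0) (fun n => Some (w *+ (L %/ n))).

Definition unitpart (x : option G) : G := odflt 0 x.

Definition lin (k : nat) (m : nat -> int) (e : nat -> option G) : G :=
  \sum_(i < k) unitpart (e i) *~ m i.

Lemma linD k m m' e : lin k (fun i => m i + m' i) e = lin k m e + lin k m' e.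
Proof. by rewrite -big_split; apply: eq_bigr => i _; rewrite mulrzDr. Qed.

Lemma linN k m e : lin k (fun i => - m i) e = - lin k m e.
Proof. by rewrite -sumrN; apply: eq_bigr => i _; rewrite mulrNz. Qed.

Lemma linB k m m' e : lin k (fun i => m i - m' i) e = lin k m e - lin k m' e.
Proof. by rewrite linD linN. Qed.

Lemma linZ k m z e : lin k (fun i => m i * z) e = lin k m e *~ z.
Proof. by rewrite /lin mulrz_suml; apply: eq_bigr => i _; rewrite mulrzA. Qed.

Lemma lin_scons k m x e : lin k.+1 m (scons x e) =
  unitpart x *~ m 0%N + lin k (fun i => m i.+1) e.
Proof. by rewrite /lin big_ord_recl. Qed.

Lemma lin0 k e : lin k (fun=> 0) e = 0.
Proof. by rewrite /lin big1 // => i _; rewrite mulr0z. Qed.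

Lemma lin_delta k n e : (n < k)%N -> lin k (fun i => (i == n)%:Z) e = unitpart (e n).
Proof.
move=> nk; rewrite /lin (bigD1 (Ordinal nk)) //= eqxx big1 ?addr0 // => i ni.
by rewrite (_ : (i == n :> nat) = false) //; apply/negbTE.
Qed.

End GroupStructure.

(** The value of a term without zero factors is the monomial with exponents
    [texp t] times the [tom L t]-th power of omega_L. *)
Fixpoint texp (t : term) : nat -> int :=
  match t with
  | Var n => fun i => (i == n)%:Z
  | Mul t u => fun i => texp t i + texp u i
  | Inv t => fun i => - texp t i
  | Zero | One | Omega _ => fun=> 0
  end.

Fixpoint tom (L : nat) (t : term) : int :=
  match t with
  | Mul t u => tom L t + tom L u
  | Inv t => - tom L t
  | Omega k => (L %/ k.+2)%:Z
  | Zero | One | Var _ => 0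
  end.

Fixpoint tnull (z : nat -> bool) (t : term) : bool :=
  match t with
  | Var n => z n
  | Mul t u => tnull z t || tnull z u
  | Inv t => tnull z t
  | Zero => true
  | One | Omega _ => false
  end.

Fixpoint term_size (t : term) : nat :=
  match t with
  | Var n => 1
  | Mul t u => term_size t + term_size u
  | Inv t => term_size t
  | Zero | One | Omega _ => 0
  end.

(** A bound for the exponents in the equation to which an atomic formula
    amounts. *)
Fixpoint fsize (p : formula) : nat :=
  match p with
  | Eq t u => term_size t + term_size u
  | Bot => 0
  | Imp p q => maxn (fsize p) (fsize q)
  | All p => fsize p
  end.

Fixpoint qdepth (p : formula) : nat :=
  match p with
  | Eq _ _ | Bot => 0
  | Imp p q => maxn (qdepth p) (qdepth q)
  | All p => (qdepth p).+1
  end.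

Lemma texp_size t i : (`|texp t i| <= term_size t)%N.
Proof. by elim: t => //= [n|t IHt u IHu|t IHt]; lia. Qed.

Lemma eq_tnull z z' k t : bounded_term k t ->
  (forall i, (i < k)%N -> z i = z' i) -> tnull z t = tnull z' t.
Proof.
move=> + zz'; by elim: t => //= t IHt u IHu /andP[/IHt -> /IHu ->].
Qed.

Lemma eval_gstruct (G : zmodType) (w : G) L k (e : nat -> option G) t :
  bounded_term k t ->
  eval (M := gstruct w L) e t =
  if tnull (fun i => e i == None) t then None
  else Some (lin k (texp t) e + w *~ tom L t).
Proof.
elim: t => [n nk|t IHt u IHu /andP[/IHt et /IHu eu]|t IHt /IHt et|_|_|i _] //=.
- by rewrite lin_delta // mulr0z addr0; case: (e n).
- rewrite et eu; case: (tnull _ t) => //=; case: (tnull _ u) => //=.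
  by rewrite linD mulrzDr addrACA.
- by rewrite et; case: (tnull _ t) => //=; rewrite linN mulrNz opprD.
- by rewrite lin0 mulr0z addr0.
- by rewrite lin0 add0r.
Qed.

(** The level [j] counts the quantifiers that may still follow. The domains depend
    on it because an element of a finite board must be chosen so divisible that the
    later moves can still take roots of it. *)
Fixpoint sat_in (M : structure) (dom : nat -> M -> Prop) (j : nat)
    (e : nat -> M) (p : formula) : Prop :=
  match p with
  | Eq t u => eval e t = eval e u
  | Bot => False
  | Imp p q => sat_in dom j e p -> sat_in dom j e q
  | All p => forall x : M, dom j.-1 x -> sat_in dom j.-1 (scons x e) p
  end.

Lemma sat_in_full (M : structure) j (e : nat -> M) p :
  sat_in (fun _ _ => True) j e p <-> sat e p.
Proof.
elim: p j e => [t u||p IHp q IHq|p IHp] j e //=.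
- by rewrite IHp IHq.
- by split=> Hp x; [apply/(IHp j.-1); apply: Hp|move=> _; apply/IHp].
Qed.

(** * The back-and-forth game *)

(** A board of the game: a group [agroup] with a root of unity [aroot], in
    which the elements [adom j] can be chosen when [j] more moves remain. *)
Record arena := Arena {
  agroup :> zmodType;
  aroot : agroup;
  adom : nat -> agroup -> Prop
}.

Definition in_dom (A : arena) (j : nat) (x : option A) : Prop :=
  if x is Some g then adom j g else True.

(** What [extend] needs in order to answer a move after which [j] moves remain,
    if relations with exponents up to [N] are to be preserved. *)
Record rich (A : arena) (N j : nat) : Prop := Rich {
  rich_mono : forall x : A, adom j.+1 x -> adom j x;
  rich_torsion : forall s (x : A), (0 < s <= N)%N -> x *+ s = 0 ->
    exists c : int, x = aroot A *~ c;
  rich_root : forall k (e : nat -> option A) n m c,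
    (forall i, (i < k)%N -> in_dom j.+1 (e i)) -> (0 < n <= N)%N ->
    exists2 y, adom j y & y *+ n = lin k m e + aroot A *~ c;
  rich_generic : forall k (e : nat -> option A),
    (forall i, (i < k)%N -> in_dom j.+1 (e i)) ->
    exists2 y, adom j y & forall n m c, (0 < n <= N)%N ->
      (forall i, (i < k)%N -> (`|m i| <= N)%N) ->
      y *+ n <> lin k m e + aroot A *~ c
}.

(** What formulas see of a position when exponents up to [N] matter. Zero entries
    do not contribute to [lin], so the equations concern the nonzero ones. *)
Definition alike (A B : arena) (k N : nat)
    (e : nat -> option A) (f : nat -> option B) : Prop :=
  (forall i, (i < k)%N -> (e i == None) = (f i == None)) /\
  (forall m c, (forall i, (i < k)%N -> (`|m i| <= N)%N) ->
     lin k m e = aroot A *~ c <-> lin k m f = aroot B *~ c).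

Lemma alike_sym (A B : arena) k N (e : nat -> option A) (f : nat -> option B) :
  alike k N e f -> alike k N f e.
Proof.
by move=> [null_ef lin_ef]; split=> [i /null_ef ->|m c /lin_ef ->].
Qed.

Section SmallRelation.

Variables (A : arena) (k N : nat) (e : nat -> option A) (g : A).

Definition relation (n : nat) (m : nat -> int) (c : int) : Prop :=
  g *+ n = lin k m e + aroot A *~ c.

(** The bound on the exponents in a relation shrinks with growing [n], in such
    a way that the remainder of a relation modulo a shorter one is again
    small; see [bnd_lt]. *)
Definition bnd (n : nat) : nat := N * N.+1 ^ (N - n).

Definition small_relation (n : nat) : Prop :=
  (0 < n <= N)%N /\
  exists m c, (forall i, (i < k)%N -> (`|m i| <= bnd n)%N) /\ relation n m c.

Lemma bnd_ge n : (N <= bnd n)%N.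
Proof. by rewrite leq_pmulr // expn_gt0. Qed.

Lemma bnd_leq n n' : (n <= n')%N -> (bnd n' <= bnd n)%N.
Proof. by move=> nn'; rewrite leq_mul2l leq_pexp2l ?orbT // leq_sub2l. Qed.

Lemma bnd_lt r n : (r < n <= N)%N -> (N.+1 * bnd n <= bnd r)%N.
Proof.
case: n => // n /andP[rn nN]; apply: leq_trans (@bnd_leq r n rn).
by rewrite /bnd mulnCA -expnS -subSn // subSS.
Qed.

Lemma bnd_max n : (N.+1 * bnd n <= N.+1 ^ N.+2)%N.
Proof.
rewrite /bnd !expnS leq_mul2l leq_mul ?orbT //.
exact: leq_pexp2l (leq_subr _ _).
Qed.

Lemma relation_rem n m c n' m' c' : relation n m c -> relation n' m' c' ->
  relation (n' %% n) (fun i => m' i - m i * (n' %/ n)%:Z) (c' - c * (n' %/ n)%:Z).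
Proof.
rewrite /relation => gn gn'; rewrite linB linZ mulrzBr mulrzA.
rewrite addrACA -opprD -mulrzDl -gn -gn' -pmulrn -mulrnA -mulrnBr; last first.
  by rewrite mulnC leq_trunc_div.
by congr (g *+ _); have := divn_eq n' n; lia.
Qed.

(** A nonzero remainder of [n'] modulo [n] would give a relation shorter than the
    shortest one. *)
Lemma relation_dvd n m c n' m' c' :
  small_relation n -> (forall r, small_relation r -> (n <= r)%N) ->
  (forall i, (i < k)%N -> (`|m i| <= bnd n)%N) -> relation n m c ->
  (n' <= N)%N -> (forall i, (i < k)%N -> (`|m' i| <= bnd n)%N) ->
  relation n' m' c' -> (n %| n')%N.
Proof.
move=> [/andP[n0 nN] _] n_min mn gn n'N m'n gn'; rewrite /dvdn.
have rn : (n' %% n < n)%N by rewrite ltn_mod.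
case: posnP => // r0; suff /n_min : small_relation (n' %% n) by rewrite leqNgt rn.
split; first by rewrite r0 (leq_trans (ltnW rn)).
eexists; eexists; split; last exact: relation_rem gn gn'.
move=> i ik /=; apply: leq_trans (@bnd_lt _ n _); last by rewrite rn.
have qN : (n' %/ n <= N)%N by apply: leq_trans (leq_div _ _) n'N.
move: (mn i ik) (m'n i ik) => mi m'i; rewrite mulSn.
have : (`|(m i * (n' %/ n)%:Z)%R| <= N * bnd n)%N by rewrite abszM mulnC leq_mul.
lia.
Qed.

End SmallRelation.

(** Bounds all exponents that occur in the proof of [extend]; see [bnd_max]. *)
Definition next_level (N : nat) : nat := N.+1 ^ N.+2.

Lemma leq_next_level N : (N <= next_level N)%N.
Proof.
apply: leq_trans (leqnSn N) _; rewrite -{1}(expn1 N.+1).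
exact: leq_pexp2l.
Qed.

Lemma eq_addsub (V : zmodType) (a b c d : V) : a + b = c + d <-> c - a = b - d.
Proof.
split=> E; first by rewrite -(addrK d c) -E [LHS]addrAC [a + b]addrC addrK.
by rewrite -(subrK d b) -E addrA [a + _]addrC subrK.
Qed.

Lemma relation_transfer (A B : arena) k N e f (g : A) (h : B) n m c q m' c' :
  alike k (next_level N) e f ->
  relation k e g n m c -> relation k f h n m c ->
  (forall i, (i < k)%N -> (`|(m' i - m i * q%:Z)%R| <= next_level N)%N) ->
  relation k e g (q * n) m' c' <-> relation k f h (q * n) m' c'.
Proof.
have E (C : arena) (e' : nat -> option C) g' : relation k e' g' n m c ->
    relation k e' g' (q * n) m' c' <->
    lin k (fun i => m' i - m i * q%:Z) e' = aroot C *~ (c * q%:Z - c').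
  rewrite /relation => gn; rewrite mulnC mulrnA gn linB linZ mulrzBr mulrzA.
  by rewrite mulrnDl !pmulrn eq_addsub.
by move=> [_ ef] /E -> /E -> /ef ->.
Qed.

Lemma alike_scons (A B : arena) k N (e : nat -> option A) (f : nat -> option B) g h :
  alike k N e f ->
  (forall n m c, (0 < n <= N)%N -> (forall i, (i < k)%N -> (`|m i| <= N)%N) ->
     relation k e g n m c <-> relation k f h n m c) ->
  alike k.+1 N (scons (Some g) e) (scons (Some h) f).
Proof.
move=> [null_ef lin_ef] gh; split=> [[|i] //= /null_ef //|m c mN].
rewrite !lin_scons /=; have m0N := mN 0%N erefl.
have mSN i : (i < k)%N -> (`|m i.+1| <= N)%N by move=> ik; apply: mN.
case: (m 0%N) m0N => [[|n]|n] nN; first by rewrite !mulr0z !add0r; apply: lin_ef.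
- have E (C : arena) e' (g' : C) : g' *~ n.+1 + lin k (fun i => m i.+1) e' =
      aroot C *~ c <-> relation k e' g' n.+1 (fun i => - m i.+1) c.
    rewrite /relation linN -pmulrn.
    by split=> [<-|->]; rewrite [- _ + _]addrC ?addrK ?subrK.
  rewrite !E; apply: gh => // i ik; rewrite abszN; exact: mSN.
- have E (C : arena) e' (g' : C) : g' *~ Negz n + lin k (fun i => m i.+1) e' =
      aroot C *~ c <-> relation k e' g' n.+1 (fun i => m i.+1) (- c).
    rewrite /relation NegzE !mulrNz -pmulrn; split=> [<-|->].
      by rewrite opprD opprK addrCA subrr addr0.
    by rewrite opprD opprK addrAC addNr add0r.
  rewrite !E; apply: gh => // i ik; exact: mSN.
Qed.

Lemma alike_leq (A B : arena) k N N' (e : nat -> option A) (f : nat -> option B) :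
  (N <= N')%N -> alike k N' e f -> alike k N e f.
Proof.
move=> NN' [null_ef lin_ef]; split=> // m c mN; apply: lin_ef => i /mN mi.
exact: leq_trans mi NN'.
Qed.

(** The length [r] of a shortest relation for [h] divides [n]. Pulled back to [e],
    it becomes an equation for [g] that holds up to the power [n %/ r]. Its two
    sides differ by an element of order at most [N], a power of [aroot], which
    the equation can absorb. *)
Lemma small_relation_back (A B : arena) k N e f (g : A) (h : B) n m c r :
  (forall s (x : A), (0 < s <= N)%N -> x *+ s = 0 ->
     exists c : int, x = aroot A *~ c) ->
  alike k (next_level N) e f ->
  (0 < n <= N)%N -> (forall i, (i < k)%N -> (`|m i| <= bnd N n)%N) ->
  relation k e g n m c -> relation k f h n m c ->
  small_relation k N f h r -> (forall r', small_relation k N f h r' -> (r <= r')%N) ->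
  small_relation k N e g r.
Proof.
move=> torsion ef nN mn gn hn r_small r_min.
have /andP[n0 nN'] := nN.
have n_small : small_relation k N f h n by split=> //; exists m, c.
have rn := r_min _ n_small.
have [rN [m' [c' [m'r hr]]]] := r_small.
have /andP[r0 rN'] := rN.
have mr i : (i < k)%N -> (`|m i| <= bnd N r)%N.
  by move=> ik; apply: leq_trans (mn i ik) (bnd_leq N rn).
have /dvdnP[s ns] := relation_dvd r_small r_min m'r hr nN' mr hn.
have sn : (s <= n)%N by rewrite ns leq_pmulr.
have s0 : (0 < s)%N by case: s ns sn => //; rewrite mul0n => E; rewrite E in n0.
have sN : (0 < s <= N)%N by rewrite s0 (leq_trans sn).
split=> //.
have b i : (i < k)%N -> (`|(m i - m' i * s%:Z)%R| <= next_level N)%N.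
  move=> ik; apply: leq_trans (bnd_max N r).
  have : (`|(m' i * s%:Z)%R| <= N * bnd N r)%N.
    by rewrite abszM mulnC leq_mul ?m'r //; case/andP: sN.
  by move: (mr i ik); rewrite mulSn; lia.
have : lin k (fun i => m i - m' i * s%:Z) f = aroot B *~ (c' * s%:Z - c).
  rewrite linB linZ mulrzBr mulrzA; apply: (iffLR (eq_addsub _ _ _ _)).
  by rewrite -mulrzDl -hr -pmulrn -mulrnA mulnC -ns hn.
move/(ef.2 _ _ b); rewrite linB linZ mulrzBr mulrzA => /(iffRL (eq_addsub _ _ _ _)).
rewrite -mulrzDl -gn ns mulnC mulrnA -pmulrn => E.
have [d gd] : exists d, g *+ r - (lin k m' e + aroot A *~ c') = aroot A *~ d.
  by apply: (torsion s) => //; rewrite mulrnBl E subrr.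
exists m', (c' + d); split=> // ; rewrite /relation mulrzDr addrA -gd.
by rewrite addrC subrK.
Qed.

(** Answer [g] by an element with the same shortest small relation, if there is one,
    and by a generic element otherwise. Every small relation is a multiple of the
    shortest one, up to a relation among the entries of the given positions alone,
    where these agree. *)
Lemma extend (A B : arena) k N j (e : nat -> option A) (f : nat -> option B) x :
  rich A N j -> rich B N j -> alike k (next_level N) e f ->
  (forall i, (i < k)%N -> in_dom j.+1 (f i)) ->
  exists2 y, in_dom j y & alike k.+1 N (scons x e) (scons y f).
Proof.
move=> richA richB ef fdom; have efN := alike_leq (leq_next_level N) ef.
case: x => [g|]; last first.
  exists None => //; case: efN => null_ef lin_ef.
  split=> [[|i] //= /null_ef //|m c mN].
  rewrite !lin_scons /= !mul0rz !add0r; apply: lin_ef => i ik; exact: mN.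
have [[n0 n0_small]|no_small] := pselect (exists n, small_relation k N e g n);
  last first.
  have [h hdom hgen] := rich_generic richB fdom.
  exists (Some h) => //; apply: alike_scons => // n m c nN mN.
  split=> [gn|/hgen]; last by case.
  case: no_small; exists n; split=> //; exists m, c; split=> // i ik.
  exact: leq_trans (mN i ik) (bnd_ge N n).
have [n /asboolP n_small n_min] : exists2 n, `[< small_relation k N e g n >] &
    forall r, small_relation k N e g r -> (n <= r)%N.
  have exn : exists n, `[< small_relation k N e g n >] by exists n0; apply/asboolP.
  exists (ex_minn exn); case: ex_minnP => // n /asboolP _ n_min r rs.
  by apply: n_min; apply/asboolP.
have [nN [m [c [mn gn]]]] := n_small; have /andP[n_gt0 nN'] := nN.
have [h hdom hn] := rich_root richB m c fdom nN.
exists (Some h) => //; apply: alike_scons => // n' m' c' /andP[n'0 n'N] m'N.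
have hn_small : small_relation k N f h n by split=> //; exists m, c.
have hn_min r : small_relation k N f h r -> (n <= r)%N.
  move=> rs; have exr : exists r, `[< small_relation k N f h r >].
    by exists r; apply/asboolP.
  case: (ex_minnP exr) => r' /asboolP r's r'_min.
  have r'_min' s : small_relation k N f h s -> (r' <= s)%N.
    by move=> ss; apply: r'_min; apply/asboolP.
  apply: leq_trans (r'_min' _ rs); apply: n_min.
  exact: small_relation_back (rich_torsion richA) ef nN mn gn hn r's r'_min'.
have m'n i : (i < k)%N -> (`|m' i| <= bnd N n)%N.
  by move=> ik; apply: leq_trans (m'N i ik) (bnd_ge N n).
have [/dvdnP[q n'q]|ndvd] := boolP (n %| n')%N; last first.
  by split=> [gn'|hn']; case/negP: ndvd;
    [apply: relation_dvd gn n'N m'n gn'|apply: relation_dvd hn n'N m'n hn'].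
rewrite n'q; apply: relation_transfer ef gn hn _ => i ik.
apply: leq_trans (bnd_max N n).
have qN : (q <= N)%N by apply: leq_trans n'N; rewrite n'q leq_pmulr.
have : (`|(m i * q%:Z)%R| <= N * bnd N n)%N by rewrite abszM mulnC leq_mul ?mn.
by move: (m'n i ik); rewrite mulSn; lia.
Qed.

(** Levels of similarity needed when [j] more moves are to come. *)
Definition level (N j : nat) : nat := iter j next_level N.

Lemma leq_level N j : (N <= level N j)%N.
Proof. by elim: j => //= j; move=> /leq_trans; apply; apply: leq_next_level. Qed.

(** Each quantifier is a move in the game, answered by [extend], and lowers the
    level of similarity by one. *)
Theorem alike_sat_in (A B : arena) (L N d : nat) p :
  (forall j, (j < d)%N -> rich A (level N j) j /\ rich B (level N j) j) ->
  forall j k (e : nat -> option A) (f : nat -> option B),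
  bounded k p -> (fsize p <= N)%N -> (qdepth p <= j)%N -> (j <= d)%N ->
  (forall i, (i < k)%N -> in_dom j (e i)) ->
  (forall i, (i < k)%N -> in_dom j (f i)) ->
  alike k (level N j) e f ->
  sat_in (M := gstruct (aroot A) L) (@in_dom A) j e p <->
  sat_in (M := gstruct (aroot B) L) (@in_dom B) j f p.
Proof.
move=> richAB; elim: p => [t u||p IHp q IHq|p IHp] j k e f //=.
- case/andP=> bt bu tuN _ jd edom fdom [null_ef lin_ef].
  rewrite !(eval_gstruct _ _ _ bt) !(eval_gstruct _ _ _ bu).
  rewrite (eq_tnull bt null_ef) (eq_tnull bu null_ef).
  case: (tnull _ t); case: (tnull _ u); try by split.
  have E (C : arena) (e' : nat -> option C) :
      Some (lin k (texp t) e' + aroot C *~ tom L t) =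
      Some (lin k (texp u) e' + aroot C *~ tom L u) <->
      lin k (fun i => texp t i - texp u i) e' = aroot C *~ (tom L u - tom L t).
    rewrite linB mulrzBr; split=> [[/esym]|/(iffRL (eq_addsub _ _ _ _)) -> //].
    exact: (iffLR (eq_addsub _ _ _ _)).
  rewrite !E; apply: lin_ef => i ik.
  apply: leq_trans (leq_level N j); apply: leq_trans tuN.
  by move: (texp_size t i) (texp_size u i); lia.
- case/andP=> bp bq; rewrite !geq_max => /andP[pN qN] /andP[pj qj] jd edom fdom ef.
  by rewrite (IHp j k e f) // (IHq j k e f).
- move=> bp pN; case: j => // j pj jd edom fdom ef /=.
  have [richA richB] := richAB j jd.
  have lower (C : arena) (e' : nat -> option C) (x : option C) :
      rich C (level N j) j ->
      (forall i, (i < k)%N -> in_dom j.+1 (e' i)) -> in_dom j x ->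
      forall i, (i < k.+1)%N -> in_dom j (scons x e' i).
    move=> richC e'dom xdom [|i] //= /e'dom; case: (e' i) => //= g.
    exact: (rich_mono richC).
  have step x y : in_dom j x -> in_dom j y ->
      alike k.+1 (level N j) (scons x e) (scons y f) ->
      sat_in (M := gstruct (aroot A) L) (@in_dom A) j (scons x e) p <->
      sat_in (M := gstruct (aroot B) L) (@in_dom B) j (scons y f) p.
    move=> xdom ydom; apply: IHp => //; first exact: ltnW.
      exact: lower edom xdom.
    exact: lower fdom ydom.
  split=> sat_p.
    move=> y ydom; have [x xdom xy] := extend y richB richA (alike_sym ef) edom.
    by apply: (iffLR (step x y xdom ydom (alike_sym xy))); apply: sat_p.
  move=> x xdom; have [y ydom xy] := extend x richA richB ef fdom.
  by apply: (iffRL (step x y xdom ydom xy)); apply: sat_p.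
Qed.

(** * The two kinds of boards *)

Definition full_arena (G : zmodType) (w : G) : arena :=
  @Arena G w (fun _ _ => True).

Lemma in_dom_full (G : zmodType) (w : G) :
  @in_dom (full_arena w) = (fun _ _ => True).
Proof. by apply: funext => j; apply: funext => -[]. Qed.

Lemma mulrz_modz (V : zmodType) (w : V) (L : nat) (c : int) :
  w *+ L = 0 -> w *~ c = w *~ (c %% L)%Z.
Proof.
move=> wL; rewrite {1}(divz_eq c L) mulrzDr mulrC mulrzA -[w *~ L]pmulrn wL.
by rewrite mul0rz add0r.
Qed.

(** As the order of [aroot] divides [L], its exponent matters modulo [L] only. *)
Lemma lin_finite (A : arena) k N L (e : nat -> option A) :
  (0 < L)%N -> aroot A *+ L = 0 -> exists s : seq A, forall m c,
    (forall i, (i < k)%N -> (`|m i| <= N)%N) -> lin k m e + aroot A *~ c \in s.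
Proof.
move=> L0 wL.
pose v (x : {ffun 'I_k -> 'I_(N + N).+1} * 'I_L) :=
  \sum_(i < k) unitpart (e i) *~ ((x.1 i)%:Z - N%:Z) + aroot A *+ x.2.
exists [seq v x | x : {ffun 'I_k -> 'I_(N + N).+1} * 'I_L] => m c mN.
have cL : (`|(c %% L)%Z| < L)%N by lia.
apply/mapP; exists ([ffun i : 'I_k => inord `|m i + N%:Z|], Ordinal cL).
  exact: mem_enum.
rewrite /v /= (mulrz_modz c wL); congr (_ + _); last first.
  by rewrite pmulrn; congr (_ *~ _); lia.
apply: eq_bigr => i _; congr (_ *~ _); rewrite ffunE.
by have := mN i (ltn_ord i) => mi; rewrite inordK; lia.
Qed.

Lemma full_rich (G : zmodType) (w : G) L N j :
  (0 < L)%N -> w *+ L = 0 ->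
  (forall n (x : G), (0 < n)%N -> exists y, y *+ n = x) ->
  (forall s : seq G, exists x, x \notin s) ->
  (forall s (x : G), (0 < s <= N)%N -> x *+ s = 0 -> exists c : int, x = w *~ c) ->
  rich (full_arena w) N j.
Proof.
move=> L0 wL div inf torsion; split=> //.
  move=> k e n m c _ /andP[n0 _].
  by have [y] := div n (lin k m e + w *~ c) n0; exists y.
move=> k e _; have [s sP] := lin_finite (A := full_arena w) k N e L0 wL.
(* Avoid [n]-th roots of elements of [s] for all [n <= N] at once by taking
   [y] with [N`!] times [y] outside a finite set. *)
have [z zs] := inf [seq x *+ (N`! %/ n) | x <- s, n <- iota 0 N.+1].
have [y yz] := div N`! z (fact_gt0 N).
exists y => // n m c /andP[n0 nN] mN yn; case/negP: zs; rewrite -yz.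
apply/allpairsP; exists (y *+ n, n); split.
- by rewrite yn; apply: sP.
- by rewrite mem_iota ltnS.
- by rewrite /= -mulrnA mulnC divnK // dvdn_fact // n0.
Qed.

(** The finite board, for [D = F ^ d.+1]: the cyclic group of order [D], with
    the multiples of [F ^ j] to choose from when [j] more moves remain. *)
Definition cyclic_arena (D F d : nat) : arena :=
  @Arena 'Z_D (F ^ d)%:R
    (fun j x => exists z : int, x = (F ^ j)%:R *~ z).

Lemma Zp_intr_eq0 D (z : int) : (1 < D)%N ->
  (z%:~R == 0 :> 'Z_D) = (D %| `|z|)%N.
Proof.
move=> D1.
have natE n : (n%:R == 0 :> 'Z_D) = (D %| n)%N.
  by rewrite -val_eqE /= Zp_nat /= (Zp_cast D1).
by case: z => n; rewrite ?NegzE ?mulrNz ?oppr_eq0 natE ?abszN.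
Qed.

Section CyclicArena.

Variables (D F d N j : nat).
Hypotheses (DE : D = (F ^ d.+1)%N) (F1 : (1 < F)%N) (jd : (j < d)%N) (NF : (N < F)%N).
Hypothesis dvdF : forall n, (0 < n <= N)%N -> (n %| F)%N.

Let D1 : (1 < D)%N.
Proof. by rewrite DE expnS (leq_trans F1) // leq_pmulr // expn_gt0 ltnW. Qed.

Lemma cyclic_lin k (e : nat -> option (cyclic_arena D F d)) m c :
  (forall i, (i < k)%N -> in_dom j.+1 (e i)) ->
  exists z : int, lin k m e + aroot (cyclic_arena D F d) *~ c = (F ^ j.+1)%:R *~ z.
Proof.
move=> edom.
suff [z ->] : exists z : int, lin k m e = (F ^ j.+1)%:R *~ z.
  exists (z + (F ^ (d - j.+1))%:Z * c); rewrite mulrzDr mulrzA /=; congr (_ + _ *~ _).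
  by rewrite -pmulrn -mulrnA -expnD subnKC.
rewrite /lin.
elim: k edom => [|k IHk] edom; first by exists 0; rewrite big_ord0 mulr0z.
have [i ik|z IHz] := IHk; first exact/edom/ltnW.
rewrite big_ord_recr /= IHz; have := edom k (ltnSn k).
case: (e k) => [g [z' ->]|_] /=; last by exists z; rewrite mul0rz addr0.
by exists (z + z' * m k); rewrite mulrzDr mulrzA.
Qed.

(** All [n <= N] divide [F], so that multiples of [F ^ j.+1] are divisible by [n]
    among the multiples of [F ^ j]. The element [F ^ j] itself is generic, since
    [n * F ^ j] is not a multiple of [F ^ j.+1] for [0 < n < F]. *)
Lemma cyclic_rich : rich (cyclic_arena D F d) N j.
Proof.
have F0 : (0 < F)%N by apply: ltnW.
split.
- move=> x [z ->]; exists (F%:Z * z); rewrite mulrzA -pmulrn -mulrnA.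
  by rewrite expnSr.
- move=> s x sN /eqP; have /dvdnP[q Fq] := dvdF sN; case/andP: sN => s0 _.
  have -> : x = (val x)%:Z%:~R by rewrite -pmulrn natr_Zp.
  move: (val x) => v.
  rewrite pmulrn -mulrzA Zp_intr_eq0 // -PoszM absz_nat.
  rewrite [X in (X %| _)%N]DE expnSr {2}Fq mulnA dvdn_pmul2r // => /dvdnP[z ->].
  exists (z * q)%:Z; rewrite /= -!pmulrn -mulrnA; congr (1 *+ _).
  by rewrite mulnCA.
- move=> k e n m c edom nN; have [z ->] := cyclic_lin m c edom.
  have /dvdnP[q Fq] := dvdF nN.
  exists ((F ^ j)%:R *~ (q%:Z * z)); first by exists (q%:Z * z).
  rewrite pmulrn -mulrzA [q%:Z * z]mulrC -mulrA mulrC mulrzA -PoszM -Fq.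
  by rewrite -pmulrn -mulrnA -expnSr.
- move=> k e edom; exists (F ^ j)%:R; first by exists 1.
  move=> n m c nN _; have [z ->] := cyclic_lin m c edom.
  have -> : (F ^ j)%:R *+ n = (F ^ j)%:Z%:~R *~ n :> 'Z_D by rewrite -!pmulrn.
  rewrite pmulrn -[_ *~ n]mulrzA -mulrzA => /eqP.
  rewrite -subr_eq0 -mulrzBr Zp_intr_eq0 // => dvdD.
  have : ((F ^ j.+1)%:Z %| (F ^ j)%:Z * n%:Z)%Z.
    rewrite -[_ * n%:Z](subrK ((F ^ j.+1)%:Z * z)); apply: rpredD.
      rewrite dvdzE absz_nat; apply: dvdn_trans dvdD.
      by rewrite DE dvdn_exp2l //; exact: ltnW.
    exact: dvdz_mulr.
  rewrite dvdzE abszM !absz_nat.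
  rewrite expnSr dvdn_pmul2l ?expn_gt0 ?F0 //; case/andP: nN => n0 nN.
  by move=> /(dvdn_leq n0); rewrite leqNgt (leq_ltn_trans nN NF).
Qed.

Lemma cyclic_order (c : int) :
  aroot (cyclic_arena D F d) *~ c = 0 <-> (F %| `|c|)%N.
Proof.
rewrite /= pmulrn -mulrzA; split=> [/eqP|dvdFc]; last apply/eqP; move: dvdFc || idtac;
rewrite Zp_intr_eq0 // abszM absz_nat DE expnSr dvdn_pmul2l ?expn_gt0 ?(ltnW F1) //.
Qed.

End CyclicArena.

(** The properties of the unit group of a model that make its full board [rich]. *)
Record unit_group (G : zmodType) (w : G) (L N : nat) : Prop := UnitGroup {
  ugroup_order : forall c : int, w *~ c = 0 <-> (L %| `|c|)%N;
  ugroup_div : forall n (x : G), (0 < n)%N -> exists y, y *+ n = x;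
  ugroup_inf : forall s : seq G, exists x, x \notin s;
  ugroup_torsion : forall s (x : G), (0 < s <= N)%N -> x *+ s = 0 ->
    exists c : int, x = w *~ c
}.

Lemma unit_group_rich (G : zmodType) (w : G) L N n j : (0 < L)%N -> (n <= N)%N ->
  unit_group w L N -> rich (full_arena w) n j.
Proof.
move=> L0 nN [order div inf torsion]; apply: full_rich L0 _ div inf _.
  by rewrite pmulrn; apply/order; rewrite absz_nat.
by move=> s x /andP[s0 sn]; apply: torsion; rewrite s0 (leq_trans sn).
Qed.

Lemma level_leq N i j : (i <= j)%N -> (level N i <= level N j)%N.
Proof.
move=> /subnK <-; rewrite /level addnC.
elim: (j - i)%N => [|n IHn]; first by rewrite addn0.
by rewrite addnS /=; apply: leq_trans IHn (leq_next_level _).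
Qed.

(** Divisible by all exponents that matter for sentences with terms of size [N] and
    [d] nested quantifiers, and because of the summand 2 also by [k.+2] for the
    constants omega_(k+2) with [k <= N]. *)
Definition modulus (N d : nat) : nat := (level N d).+2`!.

Lemma modulus_gt N d : (level N d < modulus N d)%N.
Proof. by apply: leq_trans (fact_geq _); apply: leqnSn. Qed.

Lemma modulus_gt1 N d : (1 < modulus N d)%N.
Proof. by apply: leq_trans (fact_geq _). Qed.

Lemma dvdn_modulus N d n : (0 < n <= (level N d).+2)%N -> (n %| modulus N d)%N.
Proof. by move=> nN; apply: dvdn_fact. Qed.

(** The two boards are alike at the start, when no element is chosen yet, because
    [w] and the root of the cyclic board have the same order. *)
Lemma finite_board (G : zmodType) (w : G) N d D p e f :
  D = (modulus N d ^ d.+1)%N ->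
  unit_group w (modulus N d) (level N d) ->
  sentence p -> (fsize p <= N)%N -> (qdepth p <= d)%N ->
  sat (M := gstruct w (modulus N d)) e p <->
  sat_in (M := gstruct (aroot (cyclic_arena D (modulus N d) d)) (modulus N d))
    (@in_dom (cyclic_arena D (modulus N d) d)) d f p.
Proof.
move=> DE Gw sp pN pd; set F := modulus N d in DE Gw *.
have F1 : (1 < F)%N := modulus_gt1 N d.
rewrite -(sat_in_full d) -(in_dom_full w).
apply: (@alike_sat_in (full_arena w) (cyclic_arena D F d) F N d p _ d 0) => //.
  move=> j jd; have le_jd := level_leq N (ltnW jd).
  split; first exact: unit_group_rich (ltnW F1) le_jd Gw.
  apply: cyclic_rich => //; first exact: leq_ltn_trans le_jd (modulus_gt N d).
  move=> n /andP[n0 nj]; apply: dvdn_modulus; rewrite n0.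
  by apply: leq_trans nj (leq_trans le_jd _); do 2 apply: leqW.
split=> // m c _; rewrite /lin !big_ord0.
have E : (0 = aroot (cyclic_arena D F d) *~ c) <-> (F %| `|c|)%N.
  by rewrite -(cyclic_order DE F1) //; split=> ->.
by rewrite E -(ugroup_order Gw); split=> ->.
Qed.

Lemma alike_full (G : zmodType) (w : G) L N d p k e f :
  (0 < L)%N -> unit_group w L (level N d) ->
  bounded k p -> (fsize p <= N)%N -> (qdepth p <= d)%N ->
  alike (A := full_arena w) (B := full_arena w) k (level N d) e f ->
  sat (M := gstruct w L) e p <-> sat (M := gstruct w L) f p.
Proof.
move=> L0 Gw bp pN pd ef.
rewrite -(sat_in_full d) -[X in _ <-> X](sat_in_full d) -(in_dom_full w).
apply: (@alike_sat_in (full_arena w) (full_arena w) L N d p _ d k) => //.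
- by move=> j /ltnW/(level_leq N) jd; split; apply: unit_group_rich jd Gw.
- by move=> i _; rewrite in_dom_full.
- by move=> i _; rewrite in_dom_full.
Qed.

(** * Models of the axioms *)

Section Isomorphism.

Variables (M M' : structure) (P : nat -> Prop) (h : M -> M') (h' : M' -> M).
Hypothesis hK : cancel h' h.
Hypothesis h_inj : injective h.
Hypothesis h_mul : forall x y, h (smul x y) = smul (h x) (h y).
Hypothesis h_inv : forall x, h (sinv x) = sinv (h x).
Hypothesis h_zero : h (szero M) = szero M'.
Hypothesis h_one : h (sone M) = sone M'.
Hypothesis h_omega : forall k, P k -> h (somega M k.+2) = somega M' k.+2.

Fixpoint term_omegas (t : term) : Prop :=
  match t with
  | Mul t u => term_omegas t /\ term_omegas u
  | Inv t => term_omegas t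
  | Omega k => P k
  | Var _ | Zero | One => True
  end.

(** The constants are restricted since a model of the axioms need not relate its
    roots of unity as the complex numbers do: omega_3 may be the square of omega_6
    or the inverse of that. *)
Fixpoint omegas (p : formula) : Prop :=
  match p with
  | Eq t u => term_omegas t /\ term_omegas u
  | Bot => True
  | Imp p q => omegas p /\ omegas q
  | All p => omegas p
  end.

Lemma eval_iso e t : term_omegas t -> h (eval e t) = eval (fun n => h (e n)) t.
Proof.
elim: t => //= [t IHt u IHu [/IHt <- /IHu <-]|t IHt /IHt <-]; first exact: h_mul.
exact: h_inv.
Qed.

Lemma sat_iso e p : omegas p -> sat e p <-> sat (fun n => h (e n)) p.
Proof.
elim: p e => [t u||p IHp q IHq|p IHp] e //=.
- move=> [Pt Pu]; rewrite -!eval_iso //; split=> [-> //|]; exact: h_inj.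
- by move=> [/IHp -> /IHq ->].
- move=> /IHp {}IHp.
  have sconsE x : scons (h x) (fun n => h (e n)) = (fun n => h (scons x e n)).
    by apply: funext => -[].
  split=> Hp x; first by rewrite -(hK x) sconsE; apply/IHp.
  by apply/IHp; rewrite -sconsE; apply: Hp.
Qed.

End Isomorphism.

Lemma mul_formula_omegas P p : mul_formula p -> omegas P p.
Proof.
have term_om t : mul_term t -> term_omegas P t.
  by elim: t => //= t IHt u IHu /andP[/IHt ? /IHu ?].
elim: p => //= [t u|p IHp q IHq]; first by case/andP=> /term_om ? /term_om.
by case/andP=> /IHp ? /IHq.
Qed.

Definition spow (M : structure) (x : M) (n : nat) : M :=
  iterop n (@smul M) x (sone M).

Record mult_model (M : structure) : Prop := MultModel {
  mm_assoc : forall x y z : M, smul x (smul y z) = smul (smul x y) z;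
  mm_mul1 : forall x : M, smul x (sone M) = x;
  mm_inv : forall x : M, x <> szero M -> smul x (sinv x) = sone M;
  mm_comm : forall x y : M, smul x y = smul y x;
  mm_mul0 : forall x : M, smul x (szero M) = szero M;
  mm_inv0 : szero M = sinv (szero M);
  mm_omega_neq : forall n i j, (1 < n)%N -> (i < j < n)%N ->
    spow (somega M n) i <> spow (somega M n) j;
  mm_omega : forall n (x : M), (1 < n)%N ->
    spow x n = sone M <-> exists2 i, (i < n)%N & x = spow (somega M n) i;
  mm_root : forall n (x : M), (1 < n)%N -> exists y, spow y n = x
}.

Lemma eval_Pow (M : structure) (e : nat -> M) t n :
  eval e (Pow t n) = spow (eval e t) n.
Proof.
rewrite /Pow /spow; case: n => // n; elim: n => //= n IHn.
by congr smul.
Qed.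
Lemma sat_All (M : structure) (e : nat -> M) p :
  sat e (All p) <-> forall x, sat (scons x e) p.
Proof. by []. Qed.

Lemma sat_Or (M : structure) (e : nat -> M) p q :
  sat e (Or p q) <-> sat e p \/ sat e q.
Proof.
split=> /=; last by case=> // Hp nHp.
by move=> npq; have [|/npq] := pselect (sat e p); [left|right].
Qed.

Lemma sat_And (M : structure) (e : nat -> M) p q :
  sat e (And p q) <-> sat e p /\ sat e q.
Proof.
split=> /= [npq|[Hp Hq] pnq]; last exact: pnq.
by split; apply: contrapT => n; apply: npq => // ? ?; apply: n.
Qed.

Lemma sat_Iff (M : structure) (e : nat -> M) p q :
  sat e (Iff p q) <-> (sat e p <-> sat e q).
Proof. by rewrite sat_And. Qed.

Lemma sat_Ex (M : structure) (e : nat -> M) p :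
  sat e (Ex p) <-> exists x, sat (scons x e) p.
Proof.
split=> /= [np|[x Hp] /(_ x)//]; apply: contrapT => nex; apply: np => x Hp.
by apply: nex; exists x.
Qed.

Lemma sat_Conj (M : structure) (e : nat -> M) s :
  sat e (Conj s) <-> forall p, List.In p s -> sat e p.
Proof.
elim: s => [|p s IHs]; first by split=> //= _ [].
rewrite [Conj _]/(And p (Conj s)) sat_And IHs; split=> [[Hp Hs] q /= [<-|/Hs]|H] //.
by split=> [|q qs]; apply: H; [left|right].
Qed.

Lemma sat_Disj (M : structure) (e : nat -> M) s :
  sat e (Disj s) <-> exists2 p, List.In p s & sat e p.
Proof.
elim: s => [|p s IHs]; first by split=> // -[].
rewrite [Disj _]/(Or p (Disj s)) sat_Or IHs.
split=> [[Hp|[q qs Hq]]|[q /= [<-|qs] Hq]].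
- by exists p; [left|].
- by exists q; [right|].
- by left.
- by right; exists q.
Qed.

Lemma In_mem (T : eqType) (x : T) s : List.In x s <-> x \in s.
Proof.
elim: s => //= y s IHs; rewrite in_cons; split=> [[->|/IHs ->]|].
- by rewrite eqxx.
- by rewrite orbT.
- by case/orP=> [/eqP ->|/IHs]; [left|right].
Qed.

Lemma In_flatten_map (A B : Type) (f : A -> seq B) s y :
  List.In y (flatten (map f s)) <-> exists2 x, List.In x s & List.In y (f x).
Proof.
elim: s => [|x s IHs] /=; first by split=> // -[].
rewrite List.in_app_iff IHs; split=> [[yx|[z zs yz]]|[z [<-|zs] yz]].
- by exists x; [left|].
- by exists z; [right|].
- by left.
- by right; exists z.
Qed.

Lemma bounded_Pow k t n : bounded_term k t -> bounded_term k (Pow t n).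
Proof. by rewrite /Pow; case: n => // n bt; elim: n => //= n ->; rewrite bt. Qed.

Lemma mult_axiom_sentence q : mult_axiom q -> sentence q.
Proof.
have Conj_b s : (forall p, List.In p s -> bounded 0 p) -> bounded 0 (Conj s).
  elim: s => //= p s IHs H; rewrite H ?IHs //; last by left.
  by move=> r rs; apply: H; right.
have Disj_b k s : (forall p, List.In p s -> bounded k p) -> bounded k (Disj s).
  elim: s => //= p s IHs H; rewrite H ?IHs //; last by left.
  by move=> r rs; apply: H; right.
rewrite /sentence; case=> // n n1.
- apply: Conj_b => p pF; have [j _ pj] := iffLR (In_flatten_map _ _ _) pF.
  have [i _ ->] := In_map pj.
  by rewrite /= !bounded_Pow.
- rewrite /= bounded_Pow //= Disj_b // => p pn; have [i _ ->] := In_map pn.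
  by rewrite /= bounded_Pow.
- by rewrite /= bounded_Pow.
Qed.

Lemma mult_modelP (M : structure) : models mult_axiom M <-> mult_model M.
Proof.
split=> [ax|[assoc mul1 inv comm mul0 inv0 omega_neq omegaP root] q].
  pose e0 (n : nat) := szero M; split.
  - by move=> x y z; have := ax _ M1 e0 x y z.
  - by move=> x; have := ax _ M2 e0 x.
  - by move=> x; have := ax _ M3 e0 x.
  - by move=> x y; have := ax _ M4 e0 x y.
  - move=> x.
    by have [] := iffLR (sat_And _ _ _) (iffLR (sat_All _ _) (ax _ M5 e0) x).
  - by have [] := iffLR (sat_And _ _ _) (iffLR (sat_All _ _) (ax _ M5 e0) (szero M)).
  - move=> n i j n1 /andP[ij jn]; have := iffLR (sat_Conj _ _) (ax _ (M6 n1) e0).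
    move=> /(_ (Neg (Eq (Pow (omega n) i) (Pow (omega n) j)))) /=.
    rewrite !eval_Pow /= -addn2 subnK //; apply; apply/In_flatten_map.
    exists j; first by apply/In_mem; rewrite mem_iota add0n.
    by apply: In_map_f; apply/In_mem; rewrite mem_iota add0n.
  - move=> n x n1.
    have := iffLR (sat_Iff _ _ _) (iffLR (sat_All _ _) (ax _ (M7 n1) e0) x).
    rewrite /= eval_Pow /= => ->; rewrite sat_Disj; split.
      move=> [p pn]; have [i /In_mem] := In_map pn.
      rewrite mem_iota add0n => /= i_n -> /=.
      rewrite eval_Pow /= -addn2 subnK // => ->.
      by exists i.
    move=> [i i_n ->]; exists (Eq (Var 0) (Pow (omega n) i)).
      by apply: In_map_f; apply/In_mem; rewrite mem_iota add0n.
    by rewrite /= eval_Pow /= -addn2 subnK.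
  - move=> n x n1.
    have [y] := iffLR (sat_Ex _ _) (iffLR (sat_All _ _) (ax _ (M8 n1) e0) x).
    by rewrite /= eval_Pow; exists y.
case=> [||||| n n1 | n n1 | n n1] e.
- by move=> x y z; apply: assoc.
- exact: mul1.
- exact: inv.
- by move=> x y; apply: comm.
- apply: (iffRL (sat_All _ _)) => x.
  by apply: (iffRL (sat_And _ _ _)); split; [apply: mul0|apply: inv0].
- apply: (iffRL (sat_Conj _ _)) => p pF.
  have [j /In_mem] := iffLR (In_flatten_map _ _ _) pF.
  rewrite mem_iota add0n => /= jn pj.
  have [i /In_mem] := In_map pj; rewrite mem_iota add0n => /= ij -> /=.
  rewrite !eval_Pow /= -addn2 subnK //; apply: omega_neq => //; by rewrite ij.
- apply: (iffRL (sat_All _ _)) => x; apply: (iffRL (sat_Iff _ _ _)).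
  rewrite /= eval_Pow /= omegaP // sat_Disj; split.
    move=> [i i_n ->]; exists (Eq (Var 0) (Pow (omega n) i)).
      by apply: In_map_f; apply/In_mem; rewrite mem_iota add0n.
    by rewrite /= eval_Pow /= -addn2 subnK.
  move=> [p pn]; have [i /In_mem] := In_map pn.
  rewrite mem_iota add0n => /= i_n -> /=; rewrite eval_Pow /= -addn2 subnK // => ->.
  by exists i.
- apply: (iffRL (sat_All _ _)) => x; apply: (iffRL (sat_Ex _ _)).
  have [y yx] := root n x n1.
  by exists y; rewrite /= eval_Pow.
Qed.

(** * The unit group of a model *)

Section UnitGroup.

Variables (M : structure) (HM : mult_model M).

Lemma spowS (x : M) n : spow x n.+1 = smul x (spow x n).
Proof. by rewrite /spow; case: n => //=; rewrite (mm_mul1 HM). Qed.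

Lemma smul1 (x : M) : smul (sone M) x = x.
Proof. by rewrite (mm_comm HM) (mm_mul1 HM). Qed.

Lemma sone_neq0 : sone M <> szero M.
Proof.
move=> M10; apply: (@mm_omega_neq _ HM 2 0 1) => //.
have M0 (x : M) : x = szero M by rewrite -(mm_mul1 HM x) M10 (mm_mul0 HM).
by rewrite (M0 (spow _ 0)) (M0 (spow _ 1)).
Qed.

Lemma smul_neq0 (x y : M) : x <> szero M -> y <> szero M -> smul x y <> szero M.
Proof.
move=> x0 y0 xy0; apply: y0.
rewrite -(mm_mul1 HM y) (mm_comm HM) -(mm_inv HM x0) (mm_comm HM x) -(mm_assoc HM).
by rewrite xy0 (mm_mul0 HM).
Qed.

Lemma sinv_neq0 (x : M) : x <> szero M -> sinv x <> szero M.
Proof.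
by move=> x0 ix0; apply: sone_neq0; rewrite -(mm_inv HM x0) ix0 (mm_mul0 HM).
Qed.

(** The proof [HM] occurs in the type for the sake of the group structure, which is
    inferred from the type and depends on [HM]. *)
Definition munit : Type := let _ := HM in {x : M | x <> szero M}.

Definition to_unit (x : M) (x0 : x <> szero M) : munit :=
  exist (fun y => y <> szero M) x x0.

HB.instance Definition _ := gen_eqMixin munit.
HB.instance Definition _ := gen_choiceMixin munit.

Definition munit_zero : munit := to_unit sone_neq0.
Definition munit_opp (x : munit) : munit := to_unit (sinv_neq0 (proj2_sig x)).
Definition munit_add (x y : munit) : munit :=
  to_unit (smul_neq0 (proj2_sig x) (proj2_sig y)).

Lemma munit_addA : associative munit_add.
Proof. by move=> x y z; apply: eq_exist; apply: (mm_assoc HM). Qed.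

Lemma munit_addC : commutative munit_add.
Proof. by move=> x y; apply: eq_exist; apply: (mm_comm HM). Qed.

Lemma munit_add0 : left_id munit_zero munit_add.
Proof. by move=> [x x0]; apply: eq_exist; apply: smul1. Qed.

Lemma munit_addN : left_inverse munit_zero munit_opp munit_add.
Proof.
move=> [x x0]; apply: eq_exist => /=; rewrite (mm_comm HM); exact: (mm_inv HM).
Qed.

HB.instance Definition _ :=
  GRing.isZmodule.Build munit munit_addA munit_addC munit_add0 munit_addN.

Lemma munit_natmul (x : munit) n : proj1_sig (x *+ n) = spow (proj1_sig x) n.
Proof. by elim: n => // n IHn; rewrite spowS -IHn mulrS. Qed.

Lemma munit_eq (x y : munit) : proj1_sig x = proj1_sig y -> x = y.
Proof. by case: x y => x x0 [y y0] /=; apply: eq_exist. Qed.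

Lemma spow_omega n : (1 < n)%N -> spow (somega M n) n = sone M.
Proof. by move=> n1; apply/(mm_omega HM _ n1); exists 1%N. Qed.

Lemma somega_neq0 n : (1 < n)%N -> somega M n <> szero M.
Proof.
move=> n1 w0; apply: sone_neq0; rewrite -(spow_omega n1) w0.
by case: n n1 {w0} => // n _; rewrite spowS (mm_comm HM) (mm_mul0 HM).
Qed.

Definition munit_omega n (n1 : (1 < n)%N) : munit := to_unit (somega_neq0 n1).

Lemma munit_omega_inj n (n1 : (1 < n)%N) i j : (i < n)%N -> (j < n)%N ->
  munit_omega n1 *+ i = munit_omega n1 *+ j -> i = j.
Proof.
have lt_neq i' j' : (i' < j' < n)%N -> munit_omega n1 *+ i' <> munit_omega n1 *+ j'.
  move=> ij /(congr1 (@proj1_sig _ _)); rewrite !munit_natmul.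
  exact: (mm_omega_neq HM).
move=> i_n j_n; case: (ltngtP i j) => // [ij|ji] E.
  by case: (lt_neq i j) => //; rewrite ij.
by case: (lt_neq j i) => //; rewrite ji.
Qed.

Lemma munit_unit_group L (L1 : (1 < L)%N) N :
  (forall s, (0 < s <= N)%N -> (s %| L)%N) ->
  unit_group (munit_omega L1) L N.
Proof.
move=> dvdL; set w := munit_omega L1.
have wL : w *+ L = 0 by apply: munit_eq; rewrite munit_natmul; apply: spow_omega.
split.
- move=> c; rewrite (mulrz_modz c wL).
  have cL : (0 <= (c %% L)%Z < L) by lia.
  have -> : (L %| `|c|)%N = ((c %% L)%Z == 0) by exact: (sameP (@dvdz_mod0P L c) eqP).
  case: (c %% L)%Z cL => // r rL; rewrite -pmulrn; split=> [wr|/eqP[->]//].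
  by rewrite (@munit_omega_inj _ L1 r 0) // ltnW.
- move=> n x n0; case: (ltngtP n 1%N) n0 => // [n1 _|-> _]; last by exists x.
  have [y yx] := mm_root HM (proj1_sig x) n1.
  have y0 : y <> szero M.
    move=> y0; apply: (proj2_sig x); rewrite -yx y0; case: (n) n1 => // m _.
    by rewrite spowS (mm_comm HM) (mm_mul0 HM).
  by exists (to_unit y0); apply: munit_eq; rewrite munit_natmul.
- move=> s; have n1 : (1 < (size s).+2)%N by [].
  apply: contrapT => sub.
  have : (size [seq munit_omega n1 *+ i | i <- iota 0 (size s).+2] <= size s)%N.
    apply: uniq_leq_size => [|x _].
      rewrite map_inj_in_uniq ?iota_uniq // => i j; rewrite !mem_iota.
      exact: munit_omega_inj.
    by apply: contrapT => xs; apply: sub; exists x; apply/negP.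
  by rewrite size_map size_iota; lia.
- move=> s x sN xs; have /dvdnP[q Lq] := dvdL s sN.
  have : spow (proj1_sig x) L = sone M.
    by rewrite -munit_natmul Lq mulnC mulrnA xs mul0rn.
  move=> /(mm_omega HM _ L1)[i _ xi]; exists i%:Z; rewrite -pmulrn.
  by apply: munit_eq; rewrite munit_natmul.
Qed.

Definition to_munit (x : M) : option munit :=
  if pselect (x = szero M) is right x0 then Some (to_unit x0) else None.

Definition of_munit (x : option munit) : M :=
  if x is Some u then proj1_sig u else szero M.

Lemma to_munit0 : to_munit (szero M) = None.
Proof. by rewrite /to_munit; case: pselect. Qed.

Lemma to_munitE (u : munit) : to_munit (proj1_sig u) = Some u.
Proof.
rewrite /to_munit; case: pselect => [u0|u0]; first by case: (proj2_sig u).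
by congr Some; apply: munit_eq.
Qed.

Lemma of_munitK : cancel of_munit to_munit.
Proof. by case=> [u|]; [apply: to_munitE|apply: to_munit0]. Qed.

Lemma to_munitK : cancel to_munit of_munit.
Proof. by move=> x; rewrite /to_munit; case: pselect. Qed.

Lemma sat_munit L (L1 : (1 < L)%N) (e : nat -> M) p :
  omegas (fun k => somega M k.+2 = spow (somega M L) (L %/ k.+2)) p ->
  sat e p <-> sat (M := gstruct (munit_omega L1) L) (fun n => to_munit (e n)) p.
Proof.
apply: (@sat_iso M (gstruct (munit_omega L1) L) _ to_munit of_munit).
- exact: of_munitK.
- exact: can_inj to_munitK.
- move=> x y; rewrite -[x]to_munitK -[y]to_munitK.
  case: (to_munit x) (to_munit y) => [u|] [v|]; rewrite !of_munitK /=.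
  + exact: (to_munitE (u + v)).
  + by rewrite (mm_mul0 HM) to_munit0.
  + by rewrite (mm_comm HM) (mm_mul0 HM) to_munit0.
  + by rewrite (mm_mul0 HM) to_munit0.
- move=> x; rewrite -[x]to_munitK; case: (to_munit x) => [u|]; rewrite of_munitK /=.
    exact: (to_munitE (- u)).
  by rewrite -(mm_inv0 HM) to_munit0.
- exact: to_munit0.
- exact: (to_munitE 0).
- by move=> k /= ->; rewrite -(munit_natmul (munit_omega L1)); apply: to_munitE.
Qed.

End UnitGroup.

(** * Bounds read off from the code of a formula *)

Lemma npair_ge x y : (x + y + y <= npair x y)%N.
Proof.
rewrite /npair leq_add2r -/(tri _); elim: (x + y)%N => // n IHn.
by rewrite triS; lia.
Qed.

Lemma term_size_code t : (term_size t <= (code_term t).+1)%N.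
Proof.
elim: t => //= [t IHt u IHu|t IHt].
  have := npair_ge 1 (npair (code_term t) (code_term u)).
  by have := npair_ge (code_term t) (code_term u); lia.
by have := npair_ge 2 (code_term t); lia.
Qed.

Lemma fsize_code p : (fsize p <= (code p).+2)%N.
Proof.
elim: p => //= [t u|p IHp q IHq|p IHp].
- have := npair_ge 0 (npair (code_term t) (code_term u)).
  have := npair_ge (code_term t) (code_term u).
  by move: (term_size_code t) (term_size_code u); lia.
- have := npair_ge 2 (npair (code p) (code q)).
  by have := npair_ge (code p) (code q); lia.
- by have := npair_ge 3 (code p); lia.
Qed.

Lemma qdepth_code p : (qdepth p <= code p)%N.
Proof.
elim: p => //= [p IHp q IHq|p IHp].
- have := npair_ge 2 (npair (code p) (code q)).
  by have := npair_ge (code p) (code q); lia.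
- by have := npair_ge 3 (code p); lia.
Qed.

Lemma omegas_sub (P Q : nat -> Prop) p :
  (forall k, P k -> Q k) -> omegas P p -> omegas Q p.
Proof.
move=> PQ; have term_PQ t : term_omegas P t -> term_omegas Q t.
  by elim: t => //= t IHt u IHu [/IHt ? /IHu ?].
by elim: p => //= [t u [/term_PQ ? /term_PQ ?]|p IHp q IHq [/IHp ? /IHq ?]].
Qed.

Lemma omegas_code p : omegas (fun k => (k <= code p)%N) p.
Proof.
have term_om n t : (code_term t <= n)%N -> term_omegas (fun k => (k <= n)%N) t.
  elim: t n => //= [t IHt u IHu|t IHt|k] n.
  - have := npair_ge 1 (npair (code_term t) (code_term u)).
    have := npair_ge (code_term t) (code_term u) => ? ? ?.
    by split; [apply: IHt|apply: IHu]; lia.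
  - by have := npair_ge 2 (code_term t) => ? ?; apply: IHt; lia.
  - by have := npair_ge 5 k; lia.
suff: forall n, (code p <= n)%N -> omegas (fun k => (k <= n)%N) p by apply.
elim: p => //= [t u|p IHp q IHq|p IHp] n.
- have := npair_ge 0 (npair (code_term t) (code_term u)).
  have := npair_ge (code_term t) (code_term u) => ? ? ?.
  by split; apply: term_om; lia.
- have := npair_ge 2 (npair (code p) (code q)).
  have := npair_ge (code p) (code q) => ? ? ?.
  by split; [apply: IHp|apply: IHq]; lia.
- by have := npair_ge 3 (code p) => ? ?; apply: IHp; lia.
Qed.

(** The code [c] of a formula bounds its quantifier depth and the indices of its
    constants, and [c.+2] bounds its term sizes. *)
Definition root_order (c : nat) : nat := modulus c.+2 c.

Lemma root_order_gt1 c : (1 < root_order c)%N.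
Proof. exact: modulus_gt1. Qed.

Lemma omegas_root_order p : omegas (fun k => (k.+2 %| root_order (code p))%N) p.
Proof.
apply: omegas_sub (omegas_code p) => k kp; apply: dvdn_modulus => /=.
by have := leq_level (code p).+2 (code p); lia.
Qed.

(** Whether omega_(k+2) is the power of omega_L that it is in the complex numbers,
    for [L] divisible by [k.+2]. *)
Definition coherent (M : structure) (L k : nat) : Prop :=
  somega M k.+2 = spow (somega M L) (L %/ k.+2).

Definition board_dim (c : nat) : nat := root_order c ^ c.+1.

Definition board_arena (c : nat) : arena :=
  cyclic_arena (board_dim c) (root_order c) c.

Definition board (c : nat) : structure :=
  gstruct (aroot (board_arena c)) (root_order c).

(** The right-hand side does not mention [M]: sentences with coherent constants have
    the same truth value in all models, and it can be computed. *)
Theorem model_board (M : structure) p f : mult_model M -> sentence p ->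
  omegas (coherent M (root_order (code p))) p ->
  true_in M p <->
  sat_in (M := board (code p)) (@in_dom (board_arena (code p))) (code p) f p.
Proof.
move=> HM sp coh; have L1 := root_order_gt1 (code p).
have Mp (e : nat -> M) : sat e p <->
    sat_in (M := board (code p)) (@in_dom (board_arena (code p))) (code p) f p.
  rewrite (sat_munit HM L1 e coh); apply: finite_board => //.
  - apply: munit_unit_group => s sN; apply: dvdn_modulus; lia.
  - exact: fsize_code.
  - exact: qdepth_code.
split=> [Mtrue|boardp e]; last by apply: (iffRL (Mp e)).
by apply: (iffLR (Mp (fun=> szero M))); apply: Mtrue.
Qed.

(** * Quantifier elimination *)

(** By induction on [s]: on either side of a case distinction on the truth value of
    its first formula, the property depends on the other formulas only. *)
Lemma boolean_combination (M : structure) (s : seq formula) (S : (nat -> M) -> Prop) :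
  (forall a, List.In a s -> qfree a) ->
  (forall e f, (forall a, List.In a s -> sat e a <-> sat f a) -> S e -> S f) ->
  exists2 q, qfree q & forall e : nat -> M, S e <-> sat e q.
Proof.
elim: s S => [|a s IHs] S qs Sinv.
  have [[e Se]|nS] := pselect (exists e, S e).
    exists Top => // f; split=> [_|_]; last exact: (Sinv e).
    by [].
  by exists Bot => // e; split=> // Se; apply: nS; exists e.
have half (b : bool) : exists2 q, qfree q &
    forall e : nat -> M, (sat e a <-> b) -> (S e <-> sat e q).
  pose S' (e : nat -> M) := forall f,
    (forall r, List.In r s -> sat e r <-> sat f r) -> (sat f a <-> b) -> S f.
  have [r rs|e f ef S'e g fg|q qq Sq] := IHs S'.
  - by apply: qs; right.
  - by apply: S'e => r rs; rewrite ef // fg.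
  - exists q => // e ea; rewrite -Sq; split=> [Se f ef fa|]; last exact.
    apply: (Sinv e f _ Se) => r /= [<-|/ef //]; by rewrite ea fa.
have [[q1 qf1 Sq1] [q2 qf2 Sq2]] := (half true, half false).
have qa : qfree a by apply: qs; left.
exists (And (Imp a q1) (Imp (Neg a) q2)); first by rewrite /= qa qf1 qf2.
move=> e; rewrite sat_And /=.
have [ea|nea] := pselect (sat e a).
  by rewrite (Sq1 e) //; split=> [q1e|[/(_ ea)]]//; split.
by rewrite (Sq2 e) //; split=> [q2e|[_ /(_ nea)]]//; split.
Qed.

Definition zpow_term (i : nat) (z : int) : term :=
  match z with Posz n => Pow (Var i) n | Negz n => Inv (Pow (Var i) n.+1) end.

Definition monomial (k : nat) (m : nat -> int) : term :=
  foldr Mul One [seq zpow_term i (m i) | i <- iota 0 k].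

Definition monomial_atom (k L : nat) (m : nat -> int) (c : nat) : formula :=
  Eq (monomial k m) (Pow (omega L) c).

(** The exponents between [- N] and [N], indexed by a finite type. *)
Definition shifted_exponents (k N : nat) (x : {ffun 'I_k -> 'I_(N + N).+1})
    (i : nat) : int :=
  if insub i is Some j then (x j)%:Z - N%:Z else 0.

Definition atoms (k N L : nat) : seq formula :=
  [seq Eq (Var i) Zero | i <- iota 0 k] ++
  [seq monomial_atom k L (shifted_exponents x.1) x.2
    | x : {ffun 'I_k -> 'I_(N + N).+1} * 'I_L].

Lemma texp_Pow t n i : texp (Pow t n) i = texp t i * n%:Z.
Proof.
rewrite /Pow; case: n => [|n] /=; first by rewrite mulr0.
by elim: n => [|n /= ->]; lia.
Qed.

Lemma tom_Pow L t n : tom L (Pow t n) = tom L t * n%:Z.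
Proof.
rewrite /Pow; case: n => [|n] /=; first by rewrite mulr0.
by elim: n => [|n /= ->]; lia.
Qed.

Lemma tnull_Pow z t n : tnull z (Pow t n) = (n != 0%N) && tnull z t.
Proof.
by rewrite /Pow; case: n => //= n; elim: n => //= n ->; rewrite orbb.
Qed.

Lemma bounded_zpow k i z : (i < k)%N -> bounded_term k (zpow_term i z).
Proof.
by move=> ik; case: z => n; [apply: bounded_Pow|apply: (bounded_Pow n.+1)].
Qed.

Lemma texp_zpow i z j : texp (zpow_term i z) j = if j == i then z else 0.
Proof.
case: z => n; rewrite /zpow_term; first by rewrite texp_Pow /=; case: eqP; lia.
by rewrite /texp -/texp texp_Pow /=; case: eqP; lia.
Qed.

Lemma tom_zpow L i z : tom L (zpow_term i z) = 0.
Proof.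
case: z => n; rewrite /zpow_term; first by rewrite tom_Pow mul0r.
by rewrite /tom -/tom tom_Pow mul0r oppr0.
Qed.

Lemma tnull_zpow p i z : tnull p (zpow_term i z) = (z != 0) && p i.
Proof.
case: z => n; rewrite /zpow_term; first by rewrite tnull_Pow.
by rewrite /tnull -/tnull tnull_Pow.
Qed.

Lemma bounded_monomial k m : bounded_term k (monomial k m).
Proof.
rewrite /monomial; have: all (ltn^~ k) (iota 0 k).
  by apply/allP => i; rewrite mem_iota add0n.
by elim: (iota 0 k) => //= i s IHs /andP[ik /IHs ->]; rewrite bounded_zpow.
Qed.

Lemma texp_monomial k m i : (i < k)%N -> texp (monomial k m) i = m i.
Proof.
move=> ik; have : i \in iota 0 k by rewrite mem_iota add0n.
rewrite /monomial; elim: (iota 0 k) (iota_uniq 0 k) => //= j s IHs /andP[js us].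
rewrite in_cons texp_zpow; case: eqP => [->|_ /= is_]; last by rewrite add0r IHs.
move=> _; rewrite -[RHS]addr0; congr (_ + _).
elim: s js {IHs us} => //= l s IHs; rewrite in_cons negb_or => /andP[jl /IHs ->].
by rewrite texp_zpow (negbTE jl).
Qed.

Lemma tom_monomial L k m : tom L (monomial k m) = 0.
Proof.
by rewrite /monomial; elim: (iota 0 k) => //= i s ->; rewrite tom_zpow.
Qed.

Lemma tnull_monomial z k m :
  tnull z (monomial k m) = has (fun i => (m i != 0) && z i) (iota 0 k).
Proof.
by rewrite /monomial; elim: (iota 0 k) => //= i s ->; rewrite tnull_zpow.
Qed.

Lemma lin_eq (G : zmodType) k m m' (e : nat -> option G) :
  (forall i, (i < k)%N -> m i = m' i \/ e i = None) -> lin k m e = lin k m' e.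
Proof.
move=> mm'; apply: eq_bigr => i _.
by case: (mm' i (ltn_ord i)) => -> //=; rewrite !mul0rz.
Qed.

(** The equations in [alike] treat zero entries as if they were 1, whereas a
    monomial containing one of them is zero. Agreement on which entries are zero
    allows to leave them out of the monomials. *)
Lemma atoms_alike (G : zmodType) (w : G) k N L (e f : nat -> option G) :
  (1 < L)%N -> w *+ L = 0 ->
  (forall a, List.In a (atoms k N L) ->
     sat (M := gstruct w L) e a <-> sat (M := gstruct w L) f a) ->
  alike (A := full_arena w) (B := full_arena w) k N e f.
Proof.
move=> L1 wL ef.
have null_ef i : (i < k)%N -> (e i == None) = (f i == None).
  move=> ik; have := ef (Eq (Var i) Zero); rewrite /= => {}ef.
  apply/eqP/eqP; apply ef; apply/List.in_app_iff; left;
    apply/(In_map_f (fun i => Eq (Var i) Zero));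
    by apply/In_mem; rewrite mem_iota add0n.
split=> // m c mN.
pose m' i := if e i == None then 0 else m i.
have -> : lin k m e = lin k m' e.
  by apply: lin_eq => i _; rewrite /m'; case: eqP; [right|left].
have -> : lin k m f = lin k m' f.
  by apply: lin_eq => i ik; rewrite /m' null_ef //; case: eqP; [right|left].
rewrite !(mulrz_modz c wL).
have cL : (`|(c %% L)%Z| < L)%N by lia.
have -> : (c %% L)%Z = `|(c %% L)%Z|%N%:Z by lia.
set c' := `|(c %% L)%Z|%N in cL *.
pose x : {ffun 'I_k -> 'I_(N + N).+1} := [ffun i : 'I_k => inord `|m' i + N%:Z|].
have xm i : (i < k)%N -> shifted_exponents x i = m' i.
  move=> ik; rewrite /shifted_exponents insubT /= ffunE /=.
  have := mN i ik; rewrite /m'; case: eqP => _ mi; rewrite inordK; lia.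
have E (g : nat -> option G) :
    (forall i, (i < k)%N -> (g i == None) = (e i == None)) ->
    sat (M := gstruct w L) g (monomial_atom k L (shifted_exponents x) c') <->
    lin k m' g = w *~ c'%:Z.
  move=> ge; rewrite /monomial_atom /= (eval_gstruct _ _ _ (bounded_monomial _ _)).
  rewrite (@eval_gstruct _ _ _ k _ (Pow _ _)); last exact: bounded_Pow.
  rewrite tnull_monomial tnull_Pow /= andbF.
  have -> : has (fun i => (shifted_exponents x i != 0) && (g i == None)) (iota 0 k)
      = false.
    apply/hasPn => i; rewrite mem_iota add0n /= => ik.
    by rewrite xm // /m' ge //; case: (e i == None); rewrite ?eqxx ?andbF.
  rewrite tom_monomial mulr0z addr0 tom_Pow /= -(addn2 (L - 2)) subnK //.
  rewrite divnn (ltnW L1) mul1r.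
  rewrite (lin_eq (m' := m')); last by move=> i ik; left; rewrite texp_monomial ?xm.
  rewrite (lin_eq (m := texp _) (m' := fun=> 0)); last first.
    by move=> i ik; left; rewrite texp_Pow mul0r.
  by rewrite lin0 add0r; split=> [[]|->].
rewrite -!E //; last by move=> i /null_ef.
apply: ef; apply/List.in_app_iff; right.
pose T : finType := ({ffun 'I_k -> 'I_(N + N).+1} * 'I_L)%type.
have xT : List.In (x, Ordinal cL) (enum T) by apply/In_mem; rewrite mem_enum.
exact: (In_map_f (fun x : T => monomial_atom k L (shifted_exponents x.1) x.2) xT).
Qed.

Lemma atoms_qfree k N L a : List.In a (atoms k N L) -> qfree a.
Proof.
move=> /List.in_app_iff[ai|ax]; first by have [i _ ->] := In_map ai.
by have [x _ ->] := In_map ax.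
Qed.

Lemma atoms_omegas (P : nat -> Prop) k N L a :
  P (L - 2)%N -> List.In a (atoms k N L) -> omegas P a.
Proof.
move=> PL; have Pow_om t n : term_omegas P t -> term_omegas P (Pow t n).
  by rewrite /Pow; case: n => // n Pt; elim: n => //= n ?; split.
move=> /List.in_app_iff[ai|ax]; first by have [i _ ->] := In_map ai.
have [x _ ->] := In_map ax; split; last exact: Pow_om.
rewrite /monomial; elim: (iota 0 k) => //= i s IHs; split=> //.
by case: (shifted_exponents x.1 i) => n; [apply: Pow_om|apply: (@Pow_om _ n.+1)].
Qed.

Theorem model_qe (M : structure) : mult_model M ->
  (forall L k, (k.+2 %| L)%N -> (1 < L)%N -> coherent M L k) -> admits_qe M.
Proof.
move=> HM coh p.
have [L [L1 dvdL omL]] : exists L, [/\ (1 < L)%N,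
    forall s, (0 < s <= level (code p).+2 (code p))%N -> (s %| L)%N &
    omegas (fun k => (k.+2 %| L)%N) p].
  exists (root_order (code p)).
  split; [exact: root_order_gt1| |exact: omegas_root_order].
  by move=> s /andP[s0 sN]; apply: dvdn_modulus; rewrite s0; do 2 apply: leqW.
have Mw := munit_unit_group HM L1 dvdL.
have wL : munit_omega HM L1 *+ L = 0.
  by rewrite pmulrn; apply/(ugroup_order Mw); rewrite absz_nat.
have cohp : omegas (coherent M L) p by apply: omegas_sub omL => i iL; apply: coh.
pose N := level (code p).+2 (code p).
apply: (@boolean_combination _ (atoms (fbound p) N L)) => [a|e f ef].
  exact: atoms_qfree.
suff: sat e p <-> sat f p by case.
rewrite (sat_munit HM L1 e cohp) (sat_munit HM L1 f cohp).
apply: (alike_full (ltnW L1) Mw (k := fbound p)).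
- exact: bounded_fbound.
- exact: fsize_code.
- exact: qdepth_code.
apply: (atoms_alike L1 wL) => a aa.
have coha : omegas (coherent M L) a.
  by apply: atoms_omegas aa; apply: coh; rewrite // -(addn2 (L - 2)) subnK.
by rewrite -!(sat_munit HM L1 _ coha); apply: ef.
Qed.

(** * The complex numbers *)

Section Complex.

Variable R : realType.

Local Notation C := (complex_structure R).

Lemma complex_omegaX n k : complex_omega R n ^+ k =
  (cos (2 * pi / n%:R * k%:R) +i* sin (2 * pi / n%:R * k%:R))%C.
Proof.
elim: k => [|k IHk]; first by rewrite mulr0 cos0 sin0.
rewrite exprS IHk /complex_omega; move: (2 * pi / n%:R) => a.
have -> : a * k.+1%:R = a + a * k%:R by rewrite -natr1 mulrDr mulr1 addrC.
rewrite cosD sinD.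
by apply/eqP; rewrite eq_complex /= [cos _ * sin _ + _]addrC !eqxx.
Qed.

(** For [0 < i < n], the real part of the [i]-th power is [cos (2 x)] with
    [0 < x < pi], which is less than 1 because [sin x] is positive. *)
Lemma complex_omega_prim n : (0 < n)%N -> n.-primitive_root (complex_omega R n).
Proof.
move=> n0; rewrite /primitive_root_of_unity n0; apply/forallP => -[i i_n] /=.
have nR : n%:R != 0 :> R by rewrite pnatr_eq0 -lt0n.
rewrite unity_rootE complex_omegaX; apply/eqP.
case: (i.+1 =P n) => [->|/eqP in_].
  by rewrite divfK // mulr_natl cos2pi sin2pi eqxx.
apply/negbTE; rewrite eq_complex /=; apply/nandP; left.
set x := pi * (i.+1%:R / n%:R) : R.
have -> : 2 * pi / n%:R * i.+1%:R = x *+ 2.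
  by rewrite /x -mulr_natl; field.
have x0 : 0 < x < pi.
  rewrite mulr_gt0 ?pi_gt0 ?divr_gt0 ?ltr0n //=.
  rewrite -[X in _ < X]mulr1 ltr_pM2l ?pi_gt0 // ltr_pdivrMr ?ltr0n // mul1r ltr_nat.
  by rewrite ltn_neqAle in_.
have := sin_gt0_pi x0; have := cos2Dsin2 x; rewrite cos_mulr2n => xx sx.
apply/eqP; have : 0 < sin x ^+ 2 by rewrite exprn_gt0.
by move=> s2 c2; move: xx c2 s2; set a := cos x ^+ 2; set b := sin x ^+ 2; lra.
Qed.

Lemma complex_spow (x : C) n : spow x n = (x : R[i]) ^+ n.
Proof. by []. Qed.

Lemma complex_model : mult_model C.
Proof.
split=> /=.
- exact: mulrA.
- exact: mulr1.
- by move=> x /eqP; apply: divff.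
- exact: mulrC.
- exact: mulr0.
- by rewrite invr0.
- move=> n i j n1 /andP[ij jn]; rewrite !complex_spow => /eqP.
  rewrite (eq_prim_root_expr (complex_omega_prim (ltnW n1))) !modn_small //.
    by rewrite ltn_eqF.
  exact: ltn_trans jn.
- move=> n x n1; rewrite complex_spow; have prim := complex_omega_prim (ltnW n1).
  split=> [/(prim_rootP prim)[i ->]|[i _ ->]].
    by exists i => //; rewrite complex_spow.
  by rewrite complex_spow exprAC (prim_expr_order prim) expr1n.
- move=> n x n1; exists (n.-root (x : R[i])); rewrite complex_spow.
  by rewrite rootCK // ltnW.
Qed.

Lemma complex_coherent L k : (k.+2 %| L)%N -> (1 < L)%N -> coherent C L k.
Proof.
move=> /dvdnP[q ->] L1; rewrite /coherent complex_spow mulnK // /= complex_omegaX.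
have q0 : q%:R != 0 :> R by case: q L1 => // q _; rewrite pnatr_eq0.
have k0 : k.+2%:R != 0 :> R by rewrite pnatr_eq0.
have -> : 2 * pi / (q * k.+2)%:R * q%:R = 2 * pi / k.+2%:R :> R.
  by rewrite natrM; move: (k.+2%:R) (q%:R) k0 q0 => b a b0 a0; field; rewrite b0.
by [].
Qed.

End Complex.

Theorem complex_complete (R : realType) :
  completely_axiomatizes_mul mult_axiom (complex_structure R).
Proof.
move=> p sp mp; have HC := complex_model R.
split=> [Cp|]; last by apply: provable_true; apply/mult_modelP.
apply: completeness => // [q|M /mult_modelP HM]; first exact: mult_axiom_sentence.
have f := fun _ : nat => @None (board_arena (code p)).
apply: (iffRL (model_board f HM sp _)); first exact: mul_formula_omegas.
by apply: (iffLR (model_board f HC sp _)) Cp; apply: mul_formula_omegas.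
Qed.

Theorem complex_qe (R : realType) : admits_qe (complex_structure R).
Proof. by apply: model_qe (complex_model R) _ => L k; apply: complex_coherent. Qed.

Lemma complex_board (R : realType) p f : sentence p ->
  true_in (complex_structure R) p <->
  sat_in (M := board (code p)) (@in_dom (board_arena (code p))) (code p) f p.
Proof.
move=> sp; apply: model_board (complex_model R) sp _.
apply: omegas_sub (omegas_root_order p) => k kL.
exact: complex_coherent kL (root_order_gt1 _).
Qed.

Local Close Scope ring_scope.

(** * Recursive functions of a list of arguments *)

(** Quantifying over the length allows to read off arguments with [nth], without
    keeping track of their number. *)
Definition prf (F : seq nat -> nat) : Prop :=
  forall n, recursive (fun v : n.-tuple nat => F v).

Lemma prf_ext F G : F =1 G -> prf F -> prf G.
Proof. by move=> FG rF n; apply: Rec_ext (rF n) => v. Qed.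

Lemma recursive_const n c : recursive (fun _ : n.-tuple nat => c).
Proof.
elim: c => [|c IHc].
  by apply: (@Rec_comp n 0 _ (fun _ _ => 0) Rec_zero) => -[].
apply: Rec_ext (Rec_comp Rec_succ (h := fun _ _ => c) (fun _ => IHc)) => v.
by rewrite /thead tnth_mktuple.
Qed.

Lemma recursive_nth n i : recursive (fun v : n.-tuple nat => nth 0 v i).
Proof.
have [i_n|n_i] := ltnP i n.
  by apply: Rec_ext (Rec_proj (Ordinal i_n)) => v; rewrite (tnth_nth 0).
apply: Rec_ext (recursive_const n 0) => v.
by rewrite nth_default // size_tuple.
Qed.

(** The number of components of [s v] may depend on the length of [v], which covers
    [prf_drop] and [prf_cons] besides the usual composition. *)
Lemma prf_subst F m (h : nat -> seq nat -> nat) (s : seq nat -> seq nat) :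
  prf F -> (forall i, prf (h i)) ->
  (forall v, s v = [seq h i v | i <- iota 0 (m (size v))]) ->
  prf (fun v => F (s v)).
Proof.
move=> rF rh sE n.
apply: Rec_ext (Rec_comp (rF (m n)) (h := fun i v => h i v) (fun i => rh i n)) => v.
congr F; rewrite sE size_tuple; apply: (@eq_from_nth _ 0).
  by rewrite size_tuple size_map size_iota.
move=> i; rewrite size_tuple => im; rewrite (nth_map 0) ?size_iota // nth_iota //.
by rewrite -(tnth_nth 0 _ (Ordinal im)) tnth_mktuple.
Qed.

Lemma prf_const c : prf (fun=> c).
Proof. by move=> n; apply: recursive_const. Qed.

Lemma prf_nth i : prf (fun v => nth 0 v i).
Proof. by move=> n; apply: recursive_nth. Qed.

Lemma prf_succ a : prf a -> prf (fun v => (a v).+1).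
Proof.
move=> ra n; have rS := Rec_comp Rec_succ (h := fun _ v => a v) (fun _ => ra n).
apply: Rec_ext rS => v.
by rewrite /thead tnth_mktuple.
Qed.

Lemma prf_drop k F : prf F -> prf (fun v => F (drop k v)).
Proof.
move=> rF; 
apply: (@prf_subst F (fun n => n - k) (fun i v => nth 0 v (k + i))) => // [i|v].
  exact: prf_nth.
apply: (@eq_from_nth _ 0) => [|i]; rewrite size_drop ?size_map ?size_iota // => ik.
by rewrite (nth_map 0) ?size_iota // nth_iota // nth_drop.
Qed.

Lemma prf_comp F (s : seq (seq nat -> nat)) : prf F ->
  (forall i, prf (nth (fun=> 0) s i)) -> prf (fun v => F [seq a v | a <- s]).
Proof.
move=> rF rs.
apply: (@prf_subst F (fun=> size s) (fun i v => nth (fun=> 0) s i v)) => // v.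
apply: (@eq_from_nth _ 0) => [|i]; rewrite !size_map ?size_iota // => i_s.
by rewrite (nth_map (fun=> 0)) // (nth_map 0) ?size_iota // nth_iota.
Qed.

Lemma prf_cons F a : prf F -> prf a -> prf (fun v => F (a v :: v)).
Proof.
move=> rF ra.
apply: (@prf_subst F S (fun i => if i is j.+1 then nth 0 ^~ j else a)) => //.
  by case=> [|i] //; apply: prf_nth.
move=> v; congr cons; apply: (@eq_from_nth _ 0) => [|i i_v].
  by rewrite size_map size_iota.
by rewrite (nth_map 0) ?size_iota // nth_iota.
Qed.

Lemma prf_nat_rect a (s : nat -> nat -> seq nat -> nat) n :
  prf a -> prf (fun v => s (nth 0 v 0) (nth 0 v 1) (drop 2 v)) -> prf n ->
  prf (fun v => nat_rect (fun=> nat) (a v) (fun k r => s k r v) (n v)).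
Proof.
move=> ra rs rn; apply: (@prf_cons (fun v => nat_rect (fun=> nat) (a (behead v))
  (fun k r => s k r (behead v)) (head 0 v))) => //.
case=> [|m].
  have := recursive_const 0 (a [::]); apply: Rec_ext => v; by rewrite (tuple0 v).
apply: Rec_ext (Rec_prim (ra m) (rs m.+2)) => v /=.
rewrite /thead (tnth_nth 0) -nth0; elim: (nth 0 v 0) => //= x ->.
by rewrite drop0.
Qed.

Definition fn1 f := prf (fun v => f (nth 0 v 0)).
Definition fn2 f := prf (fun v => f (nth 0 v 0) (nth 0 v 1)).
Lemma prf_fn1 f a : fn1 f -> prf a -> prf (fun v => f (a v)).
Proof.
by move=> rf ra; apply: (@prf_comp _ [:: a] rf) => -[|[|i]] //=; apply: prf_const.
Qed.

Lemma prf_fn2 f a b : fn2 f -> prf a -> prf b -> prf (fun v => f (a v) (b v)).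
Proof.
move=> rf ra rb; apply: (@prf_comp _ [:: a; b] rf) => -[|[|[|i]]] //=;
  exact: prf_const.
Qed.

Lemma prf_nth_drop k i : prf (fun v => nth 0 (drop k v) i).
Proof. by apply: (@prf_drop k (nth 0 ^~ i)); apply: prf_nth. Qed.

Lemma prf_nth_drop_drop k l i : prf (fun v => nth 0 (drop k (drop l v)) i).
Proof. exact: (prf_drop l (prf_nth_drop k i)). Qed.

Create HintDb prf.
#[local] Hint Resolve prf_const prf_nth prf_nth_drop prf_nth_drop_drop prf_succ : prf.

Lemma prf_add a b : prf a -> prf b -> prf (fun v => a v + b v).
Proof.
apply: prf_fn2; apply: (@prf_ext (fun v => nat_rect (fun=> nat) (nth 0 v 1)
    (fun k r => r.+1) (nth 0 v 0))).
  by move=> v; elim: (nth 0 v 0) => //= n ->.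
by apply: prf_nat_rect; auto with prf.
Qed.
#[local] Hint Resolve prf_add : prf.

Lemma prf_mul a b : prf a -> prf b -> prf (fun v => a v * b v).
Proof.
apply: prf_fn2; apply: (@prf_ext (fun v => nat_rect (fun=> nat) 0
    (fun k r => nth 0 v 1 + r) (nth 0 v 0))).
  by move=> v; elim: (nth 0 v 0) => //= n ->; rewrite mulSn.
by apply: prf_nat_rect; auto with prf.
Qed.
#[local] Hint Resolve prf_mul : prf.

Lemma prf_pred a : prf a -> prf (fun v => (a v).-1).
Proof.
apply: (@prf_fn1 predn); apply: (@prf_ext (fun v => nat_rect (fun=> nat) 0
    (fun k r => k) (nth 0 v 0))); first by move=> v; case: (nth 0 v 0).
by apply: prf_nat_rect; auto with prf.
Qed.
#[local] Hint Resolve prf_pred : prf.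

Lemma prf_sub a b : prf a -> prf b -> prf (fun v => a v - b v).
Proof.
apply: prf_fn2; apply: (@prf_ext (fun v => nat_rect (fun=> nat) (nth 0 v 0)
    (fun k r => r.-1) (nth 0 v 1))).
  by move=> v; elim: (nth 0 v 1) => [|n IHn] /=; rewrite ?subn0 // subnS -IHn.
by apply: prf_nat_rect; auto with prf.
Qed.
#[local] Hint Resolve prf_sub : prf.

Lemma prf_exp a b : prf a -> prf b -> prf (fun v => a v ^ b v).
Proof.
apply: prf_fn2; apply: (@prf_ext (fun v => nat_rect (fun=> nat) 1
    (fun k r => nth 0 v 0 * r) (nth 0 v 1))).
  by move=> v; elim: (nth 0 v 1) => //= n ->; rewrite expnS.
by apply: prf_nat_rect; auto with prf.
Qed.
#[local] Hint Resolve prf_exp : prf.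

Lemma prf_fact a : prf a -> prf (fun v => (a v)`!).
Proof.
apply: (@prf_fn1 factorial); apply: (@prf_ext (fun v => nat_rect (fun=> nat) 1
    (fun k r => k.+1 * r) (nth 0 v 0))).
  by move=> v; elim: (nth 0 v 0) => //= n ->; rewrite factS.
by apply: prf_nat_rect; auto with prf.
Qed.
#[local] Hint Resolve prf_fact : prf.

Definition prfb (p : seq nat -> bool) : Prop := prf (fun v => p v).

Lemma prfb_neg p : prfb p -> prfb (fun v => ~~ p v).
Proof.
move=> rp; apply: (@prf_ext (fun v => 1 - p v)) => [v|]; first by case: (p v).
exact: (prf_sub (prf_const 1) rp).
Qed.

Lemma prfb_and p q : prfb p -> prfb q -> prfb (fun v => p v && q v).
Proof.
move=> rp rq; apply: (@prf_ext (fun v => p v * q v)) => [v|]; first by rewrite mulnb.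
exact: prf_mul.
Qed.

Lemma prfb_or p q : prfb p -> prfb q -> prfb (fun v => p v || q v).
Proof.
move=> rp rq; apply: (@prf_ext (fun v => ~~ (~~ p v && ~~ q v))) => [v|].
  by rewrite negb_and !negbK.
exact: (prfb_neg (prfb_and (prfb_neg rp) (prfb_neg rq))).
Qed.

Lemma prfb_eq0 a : prf a -> prfb (fun v => a v == 0).
Proof.
move=> ra; apply: (@prf_ext (fun v => 1 - a v)) => [v|]; last by auto with prf.
by case: (a v).
Qed.

Lemma prfb_leq a b : prf a -> prf b -> prfb (fun v => a v <= b v).
Proof. by move=> ra rb; apply: prfb_eq0; apply: prf_sub. Qed.

Lemma prfb_eq a b : prf a -> prf b -> prfb (fun v => a v == b v).
Proof.
move=> ra rb; apply: (@prf_ext (fun v => (a v <= b v) && (b v <= a v))) => [v|].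
  by rewrite -eqn_leq.
exact: (prfb_and (prfb_leq ra rb) (prfb_leq rb ra)).
Qed.

Lemma prf_if p a b : prfb p -> prf a -> prf b ->
  prf (fun v => if p v then a v else b v).
Proof.
move=> rp ra rb; apply: (@prf_ext (fun v => p v * a v + (~~ p v) * b v)) => [v|].
  by case: (p v); rewrite ?mul1n ?mul0n ?addn0.
exact: (prf_add (prf_mul rp ra) (prf_mul (prfb_neg rp) rb)).
Qed.

Lemma prfb_if p q r : prfb p -> prfb q -> prfb r ->
  prfb (fun v => if p v then q v else r v).
Proof.
move=> rp rq rr; apply: prf_ext (prf_if rp rq rr) => v; by case: (p v).
Qed.
#[local] Hint Resolve prfb_neg prfb_and prfb_or prfb_leq prfb_eq0 prfb_eq : prf.
#[local] Hint Resolve prf_if : prf.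

Lemma prf_bool p : prfb p -> prf (fun v => p v).
Proof. by []. Qed.
#[local] Hint Resolve prf_bool : prf.

Lemma prf_sum n (f : nat -> seq nat -> nat) :
  prf (fun v => f (nth 0 v 0) (drop 2 v)) -> prf n ->
  prf (fun v => \sum_(i < n v) f i v).
Proof.
move=> rf rn; apply: (@prf_ext (fun v => nat_rect (fun=> nat) 0
    (fun k r => r + f k v) (n v))).
  by move=> v; elim: (n v) => [|m IHm] /=; rewrite ?big_ord0 // big_ord_recr /= IHm.
by apply: prf_nat_rect; auto with prf.
Qed.

Lemma prfb_all n (p : nat -> seq nat -> bool) :
  prfb (fun v => p (nth 0 v 0) (drop 2 v)) -> prf n ->
  prfb (fun v => all (p ^~ v) (index_iota 0 (n v))).
Proof.
move=> rp rn; apply: (@prf_ext (fun v => nat_rect (fun=> nat) 1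
    (fun k r => r * p k v) (n v))).
  move=> v; rewrite /index_iota subn0; elim: (n v) => // m IHm.
  by rewrite -[in RHS](addn1 m) iotaD all_cat /= IHm add0n andbT mulnb.
by apply: prf_nat_rect; auto with prf.
Qed.

Lemma prf_div a b : prf a -> prf b -> prf (fun v => a v %/ b v).
Proof.
apply: prf_fn2; apply: (@prf_ext (fun v => (~~ (nth 0 v 1 == 0)) *
    \sum_(i < nth 0 v 0) (i.+1 * nth 0 v 1 <= nth 0 v 0))).
  move=> v; set a' := nth 0 v 0; set b' := nth 0 v 1.
  case: (posnP b') => [->|b0]; first by rewrite divn0.
  rewrite mul1n (eq_bigr (fun i : 'I_a' => (i < a' %/ b') : nat)); last first.
    by move=> i _; rewrite leq_divRL.
  rewrite -(big_mkord xpredT (fun i => (i < a' %/ b') : nat)).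
  rewrite (big_cat_nat (n := a' %/ b')) ?leq_div //=.
  rewrite (eq_big_nat _ _ (F2 := fun=> 1)) => [|i /andP[_ ->] //].
  rewrite sum_nat_const_nat subn0 muln1 big_nat big1 ?addn0 //.
  by move=> i /andP[]; rewrite leqNgt => /negbTE ->.
apply: prf_mul; first by auto with prf.
by apply: (@prf_sum (nth 0 ^~ 0) (fun i v => i.+1 * nth 0 v 1 <= nth 0 v 0));
  auto with prf.
Qed.
#[local] Hint Resolve prf_div : prf.

Lemma prf_mod a b : prf a -> prf b -> prf (fun v => a v %% b v).
Proof.
move=> ra rb; apply: (@prf_ext (fun v => a v - a v %/ b v * b v));
  last by auto with prf.
by move=> v; rewrite {1}(divn_eq (a v) (b v)) addKn.
Qed.
#[local] Hint Resolve prf_mod : prf.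

Lemma prfb_dvd a b : prf a -> prf b -> prfb (fun v => a v %| b v).
Proof. by move=> ra rb; apply: prfb_eq0; auto with prf. Qed.
#[local] Hint Resolve prfb_dvd : prf.

Lemma prf_npair a b : prf a -> prf b -> prf (fun v => npair (a v) (b v)).
Proof.
move=> ra rb; apply: (@prf_ext (fun v => ((a v + b v) * (a v + b v).+1) %/ 2 + b v)).
  by move=> v; rewrite divn2.
by auto 7 with prf.
Qed.
#[local] Hint Resolve prf_npair : prf.

(** The search for the components can stop at [z] by [npair_ge]; exactly one term of
    the sum survives by [npair_inj]. *)
Definition unpair1 (z : nat) : nat :=
  \sum_(x < z.+1) \sum_(y < z.+1) x * (npair x y == z).

Definition unpair2 (z : nat) : nat :=
  \sum_(x < z.+1) \sum_(y < z.+1) y * (npair x y == z).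

Lemma npair_sum (f : nat -> nat -> nat) x y :
  \sum_(x' < (npair x y).+1) \sum_(y' < (npair x y).+1)
    f x' y' * (npair x' y' == npair x y)
  = f x y.
Proof.
have := npair_ge x y => ge_xy.
have xz : x < (npair x y).+1 by lia.
have yz : y < (npair x y).+1 by lia.
rewrite (bigD1 (Ordinal xz)) //= (bigD1 (Ordinal yz)) //= eqxx muln1.
rewrite big1 ?addn0 => [|y' yy']; last first.
  by case: eqP => [/npair_inj[_ E]|]; rewrite ?muln0 //; case/eqP: yy'; apply: val_inj.
rewrite big1 ?addn0 // => x' xx'; rewrite big1 // => y' _.
by case: eqP => [/npair_inj[E _]|]; rewrite ?muln0 //; case/eqP: xx'; apply: val_inj.
Qed.

Lemma unpair1K x y : unpair1 (npair x y) = x.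
Proof. exact: (npair_sum (fun x _ => x)). Qed.

Lemma unpair2K x y : unpair2 (npair x y) = y.
Proof. exact: (npair_sum (fun _ y => y)). Qed.

Lemma prf_unpair1 a : prf a -> prf (fun v => unpair1 (a v)).
Proof.
apply: (@prf_fn1 unpair1); apply: (@prf_sum (fun v => (nth 0 v 0).+1) (fun x v =>
  \sum_(y < (nth 0 v 0).+1) x * (npair x y == nth 0 v 0))); last by auto with prf.
apply: (@prf_sum (fun v => (nth 0 (drop 2 v) 0).+1) (fun y v => nth 0 v 0 *
  (npair (nth 0 v 0) y == nth 0 (drop 2 v) 0))); by auto 7 with prf.
Qed.

Lemma prf_unpair2 a : prf a -> prf (fun v => unpair2 (a v)).
Proof.
apply: (@prf_fn1 unpair2); apply: (@prf_sum (fun v => (nth 0 v 0).+1) (fun x v =>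
  \sum_(y < (nth 0 v 0).+1) y * (npair x y == nth 0 v 0))); last by auto with prf.
apply: (@prf_sum (fun v => (nth 0 (drop 2 v) 0).+1) (fun y v => y *
  (npair (nth 0 v 0) y == nth 0 (drop 2 v) 0))); by auto 7 with prf.
Qed.
#[local] Hint Resolve prf_unpair1 prf_unpair2 : prf.

(** * Course-of-values recursion *)

(** The values at smaller arguments, which must be less than [B], are available to
    [H] as the base [B] digits of one number. *)
Fixpoint table (B : nat) (H : nat -> nat -> nat) (n : nat) : nat :=
  if n is i.+1 then table B H i + B ^ i * H i (table B H i) else 0.

Definition digit (B T i : nat) : nat := (T %/ B ^ i) %% B.

Definition course (B : nat) (H : nat -> nat -> nat) (n : nat) : nat :=
  H n (table B H n).

Lemma digit_table B H n i : (forall j T, H j T < B) -> i < n ->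
  digit B (table B H n) i = course B H i.
Proof.
move=> HB; have B0 : 0 < B by apply: leq_ltn_trans (HB 0 0).
have Bn m : 0 < B ^ m by rewrite expn_gt0 B0.
have lt_table m : table B H m < B ^ m.
  elim: m => //= m IHm; apply: leq_trans (_ : B ^ m + B ^ m * H m (table B H m) <= _).
    by rewrite ltn_add2r.
  by rewrite -mulnS expnSr leq_mul2l HB orbT.
elim: n => // n IHn; rewrite ltnS leq_eqVlt => /orP[/eqP ->|i_n]; rewrite /digit /=.
  rewrite addnC mulnC divnMDl // divn_small ?lt_table // addn0 modn_small //.
rewrite -(IHn i_n) /digit -(subnKC (ltnW i_n)) expnD -mulnA addnC mulnC divnMDl //.
rewrite -(subnSK i_n) expnS -mulnA [B * _]mulnC addnC -modnDmr.
by rewrite modnMl addn0.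
Qed.

Lemma prf_table (B n : seq nat -> nat) (H : nat -> nat -> seq nat -> nat) :
  prf B -> prf n -> prf (fun v => H (nth 0 v 0) (nth 0 v 1) (drop 2 v)) ->
  prf (fun v => table (B v) (fun i T => H i T v) (n v)).
Proof.
move=> rB rn rH; apply: (@prf_ext (fun v => nat_rect (fun=> nat) 0
    (fun i T => T + B v ^ i * H i T v) (n v))).
  by move=> v; elim: (n v) => //= m ->.
apply: prf_nat_rect => //; first by auto with prf.
have rB' := prf_drop 2 rB; by auto 7 with prf.
Qed.

Lemma prf_digit B T i : prf B -> prf T -> prf i ->
  prf (fun v => digit (B v) (T v) (i v)).
Proof. by rewrite /digit; auto 7 with prf. Qed.
#[local] Hint Resolve prf_digit : prf.

(** * Deciding truth on the finite board *)

(** Elements of the board are coded by [0] for zero and [x.+1] for the [x]-th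
    power of the generator. *)
Definition vmul (D x y : nat) : nat :=
  if (x == 0) || (y == 0) then 0 else ((x.-1 + y.-1) %% D).+1.

Definition vinv (D x : nat) : nat :=
  if x == 0 then 0 else ((D - x.-1) %% D).+1.

Definition vomega (D F d k : nat) : nat := ((F ^ d * (F %/ k.+2)) %% D).+1.

Section Program.

Variable c : nat.

Local Notation D := (board_dim c).
Local Notation F := (root_order c).

Definition term_step (e t T : nat) : nat :=
  if unpair1 t == 0 then digit D.+1 e (unpair2 t)
  else if unpair1 t == 1 then
    vmul D (digit D.+1 T (unpair1 (unpair2 t))) (digit D.+1 T (unpair2 (unpair2 t)))
  else if unpair1 t == 2 then vinv D (digit D.+1 T (unpair2 t))
  else if unpair1 t == 3 then 0
  else if unpair1 t == 4 then 1
  else vomega D F c (unpair2 t).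

Definition term_value (e t : nat) : nat := course D.+1 (term_step e) t.

(** A state combines an environment [e], given by its base [D.+1] digits, with
    the number [j] of quantifiers that may follow. *)
Definition state (e j : nat) : nat := e * c.+1 + j.

Definition states : nat := D.+1 ^ c * c.+1.

(** The subformulas are looked up in the table [T] at the same state, or, below a
    quantifier, at the states extended by the elements of the domain. The index of
    code [p] and state [s] is [p * states + s], so that smaller codes come first. *)
Definition formula_step (i T : nat) : bool :=
  let p := i %/ states in let s := i %% states in
  let e := s %/ c.+1 in let j := s %% c.+1 in
  if unpair1 p == 0 then
    term_value e (unpair1 (unpair2 p)) == term_value e (unpair2 (unpair2 p))
  else if unpair1 p == 1 then false
  else if unpair1 p == 2 then
    ~~ (digit 2 T (unpair1 (unpair2 p) * states + s) == 1)
    || (digit 2 T (unpair2 (unpair2 p) * states + s) == 1)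
  else all (fun x => ~~ (F ^ j.-1 %| x.-1)
      || (digit 2 T (unpair2 p * states + state (x + e * D.+1) j.-1) == 1))
    (index_iota 0 D.+1).

Definition formula_value (e j p : nat) : nat :=
  course 2 formula_step (p * states + state e j).

Lemma board_dim_gt1 : 1 < D.
Proof.
by rewrite /board_dim expnS (leq_trans (root_order_gt1 c)) // leq_pmulr // expn_gt0
  (ltnW (root_order_gt1 c)).
Qed.

Definition decode (x : nat) : board c :=
  if x is y.+1 then Some (y%:R : 'Z_D)%R else None.

Lemma Zp_natr_eq m n : (m%:R == n%:R :> 'Z_D)%R = (m == n %[mod D]).
Proof. by rewrite -val_eqE /= !Zp_nat /= (Zp_cast board_dim_gt1). Qed.

Lemma decode_inj x y : x <= D -> y <= D -> decode x = decode y -> x = y.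
Proof.
case: x y => [|x] [|y] //= xD yD [] /eqP.
by rewrite Zp_natr_eq !modn_small // => /eqP ->.
Qed.

Lemma decode_surj (x : board c) : exists2 y, y <= D & decode y = x.
Proof.
case: x => [x|]; last by exists 0.
exists (nat_of_ord (x : 'Z_D)).+1; last by rewrite /= natr_Zp.
by rewrite -[X in _ < X](Zp_cast board_dim_gt1) ltn_ord.
Qed.

Lemma in_dom_decode j x : j <= c -> x <= D ->
  @in_dom (board_arena c) j (decode x) <-> F ^ j %| x.-1.
Proof.
move=> jc; case: x => [|x] xD /=; first by rewrite dvdn0.
split=> [[z xz]|/dvdnP[q ->]]; last first.
  by exists (Posz q); rewrite -pmulrn -mulrnA mulnC.
have: ((Posz x - Posz (F ^ j) * z)%:~R == 0 :> 'Z_D)%R.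
  by rewrite mulrzBr mulrzA -!pmulrn xz subrr.
rewrite (Zp_intr_eq0 _ board_dim_gt1) => Dx.
have Fx : (Posz (F ^ j) %| (Posz x - Posz (F ^ j) * z)%R)%Z.
  by rewrite dvdzE absz_nat; apply: dvdn_trans Dx; rewrite dvdn_exp2l // leqW.
have := rpredD Fx (dvdz_mulr z (dvdzz (Posz (F ^ j)))).
by rewrite subrK dvdzE !absz_nat.
Qed.

Lemma decode_mul x y : decode (vmul D x y) = smul (decode x) (decode y).
Proof.
case: x y => [|x] [|y] //=; congr Some; rewrite -natrD.
by apply/eqP; rewrite Zp_natr_eq modn_mod.
Qed.

Lemma decode_inv x : x <= D -> decode (vinv D x) = sinv (decode x).
Proof.
case: x => [|x] xD //=; congr Some; apply/eqP; rewrite -addr_eq0 -natrD.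
by rewrite (Zp_natr_eq _ 0) modnDml subnK ?modnn ?mod0n // ltnW.
Qed.

Lemma decode_omega k : decode (vomega D F c k) = somega (board c) k.+2.
Proof.
by congr Some; apply/eqP; rewrite -mulrnA Zp_natr_eq modn_mod.
Qed.

Lemma digit_lt B T i : 0 < B -> digit B T i < B.
Proof. exact: ltn_pmod. Qed.

Lemma digit_cons B x e i : x < B -> digit B (x + e * B) i = scons x (digit B e) i.
Proof.
move=> xB; have B0 : 0 < B by apply: leq_ltn_trans xB.
case: i => [|i] /=; rewrite /digit.
  by rewrite expn0 divn1 addnC modnMDl modn_small.
by rewrite expnS divnMA [x + _]addnC divnMDl // (divn_small xB) addn0.
Qed.

Lemma vmul_lt x y : vmul D x y < D.+1.
Proof.
by rewrite /vmul; case: ifP => // _; rewrite ltnS ltn_pmod // ltnW ?board_dim_gt1.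
Qed.

Lemma vinv_lt x : vinv D x < D.+1.
Proof.
by rewrite /vinv; case: ifP => // _; rewrite ltnS ltn_pmod // ltnW ?board_dim_gt1.
Qed.

Lemma term_step_lt e t T : term_step e t T < D.+1.
Proof.
rewrite /term_step; do ![case: ifP => _]; rewrite ?digit_lt ?vmul_lt ?vinv_lt //.
  exact: leq_trans board_dim_gt1 _.
by rewrite ltnS ltn_pmod // ltnW ?board_dim_gt1.
Qed.

Lemma term_valueP e t :
  decode (term_value e (code_term t)) =
  eval (M := board c) (fun n => decode (digit D.+1 e n)) t.
Proof.
have get n i : i < n -> digit D.+1 (table D.+1 (term_step e) n) i = term_value e i.
  by move=> i_n; apply: digit_table => // j T; apply: term_step_lt.
have stepE n : exists2 T, term_value e n = term_step e n T &
    forall i, i < n -> digit D.+1 T i = term_value e i.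
  by exists (table D.+1 (term_step e) n) => // i; apply: get.
elim: t (stepE (code_term t)) => [n|t IHt u IHu|t IHt|||k] [T -> {}get];
  try have {}IHt := IHt (stepE _); try have {}IHu := IHu (stepE _);
  rewrite /term_step /= !(unpair1K, unpair2K) //=.
- have := npair_ge 1 (npair (code_term t) (code_term u)).
  have := npair_ge (code_term t) (code_term u) => ? ?.
  by rewrite decode_mul (get (code_term t)) ?(get (code_term u)) ?IHt ?IHu //=; lia.
- rewrite decode_inv; last by rewrite -ltnS digit_lt.
  by have := npair_ge 2 (code_term t) => ?; rewrite (get (code_term t)) ?IHt //=; lia.
- exact: decode_omega.
Qed.

Lemma term_value_lt e t : term_value e t < D.+1.
Proof. exact: term_step_lt. Qed.

Lemma formula_valueP p e j : qdepth p <= j -> j <= c -> e < D.+1 ^ (c - j) ->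
  formula_value e j (code p) = 1 <->
  sat_in (M := board c) (@in_dom (board_arena c)) j
    (fun n => decode (digit D.+1 e n)) p.
Proof.
have B1 : 1 < D.+1 by rewrite ltnS ltnW ?board_dim_gt1.
have state_lt e' j' : j' <= c -> e' < D.+1 ^ (c - j') -> state e' j' < states.
  move=> j'c e'B; rewrite /state /states.
  have : e' < D.+1 ^ c by apply: leq_trans e'B _; rewrite leq_exp2l // leq_subr.
  by move=> e'c; have := leq_mul e'c (leqnn c.+1); rewrite mulSn; lia.
have step p' e' j' : j' <= c -> e' < D.+1 ^ (c - j') -> exists T s, [/\
    formula_value e' j' p' = (
      if unpair1 p' == 0 then
        term_value e' (unpair1 (unpair2 p')) == term_value e' (unpair2 (unpair2 p'))
      else if unpair1 p' == 1 then false
      else if unpair1 p' == 2 then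
        ~~ (digit 2 T (unpair1 (unpair2 p') * states + state e' j') == 1)
        || (digit 2 T (unpair2 (unpair2 p') * states + state e' j') == 1)
      else all (fun x => ~~ (F ^ j'.-1 %| x.-1)
          || (digit 2 T (unpair2 p' * states + state (x + e' * D.+1) j'.-1) == 1))
        s), forall x, (x \in s) = (x < D.+1) &
    forall q e'' j'', q < p' -> j'' <= c -> e'' < D.+1 ^ (c - j'') ->
      digit 2 T (q * states + state e'' j'') = formula_value e'' j'' q].
  move=> j'c e'B; have sS := state_lt e' j' j'c e'B.
  have S0 : 0 < states by apply: leq_ltn_trans sS.
  exists (table 2 formula_step (p' * states + state e' j')), (index_iota 0 D.+1).
  split; last first.
  - move=> q e'' j'' qp' j''c e''B.
    apply: (@digit_table 2 (fun i' T => formula_step i' T)) => [i' T|].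
      by case: formula_step.
    have s'S := state_lt e'' j'' j''c e''B.
    apply: (@leq_trans (q.+1 * states)); first by rewrite mulSn; lia.
    by apply: leq_trans (leq_addr _ _); rewrite leq_mul2r qp' orbT.
  - by move=> x; rewrite mem_index_iota.
  - rewrite {1}/formula_value /course {1}/formula_step.
    rewrite divnMDl // modnMDl (divn_small sS) addn0 (modn_small sS).
    (* The remaining occurrences of [state] are the indices to be looked up. *)
    rewrite {1 3 4 7}/state divnMDl // modnMDl.
    by rewrite divn_small ?ltnS // addn0 modn_small.
have boolE (b : bool) : (b : nat) = 1 <-> b by case: b.
elim: p e j => [t u||p IHp q IHq|p IHp] e j pj jc eB.
- have [T [l [-> _ _]]] := step (code (Eq t u)) e j jc eB.
  rewrite boolE /= !(unpair1K, unpair2K) /= -!term_valueP; split=> [/eqP -> //|E].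
  by apply/eqP; apply: decode_inj E; rewrite -ltnS term_value_lt.
- have [T [l [-> _ _]]] := step (code Bot) e j jc eB.
  by rewrite /= !(unpair1K, unpair2K).
- have [T [l [-> _ get]]] := step (code (Imp p q)) e j jc eB.
  move: pj; rewrite boolE /= geq_max !(unpair1K, unpair2K) /= => /andP[pj qj].
  have := npair_ge 2 (npair (code p) (code q)).
  have := npair_ge (code p) (code q) => ? ?.
  rewrite !get //=; [|lia|lia].
  rewrite -(IHp e j) // -(IHq e j) //.
  by split=> [/orP[/negP np /eqP|/eqP]|pq] //; case: eqP => //= /pq ->.
have [T [l [-> memB get]]] := step (code (All p)) e j jc eB.
case: j pj jc eB get => // j pj jc eB get.
rewrite boolE /= !(unpair1K, unpair2K) /=.
have [jc' ltp] : j <= c /\ code p < npair 3 (code p).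
  by have := npair_ge 3 (code p); lia.
have xeB x : x < D.+1 -> x + e * D.+1 < D.+1 ^ (c - j).
  move=> xD; rewrite -(subnSK jc) expnS mulnC; move: eB; set E := D.+1 ^ _ => eE.
  have := leq_mul eE (leqnn D.+1); rewrite mulSn; lia.
have scE x : x < D.+1 -> (fun n => decode (digit D.+1 (x + e * D.+1) n)) =
    scons (decode x) (fun n => decode (digit D.+1 e n)).
  by move=> xD; apply: funext => n; rewrite digit_cons //; case: n.
split=> [/allP all_p x|all_p].
  have [y yD <-] := decode_surj x; rewrite in_dom_decode // => Fy.
  have := all_p y; rewrite memB ltnS yD Fy /= => /(_ isT).
  rewrite get //; last exact: xeB.
  by move=> /eqP /(IHp (y + e * D.+1) j pj jc' (xeB y yD)); rewrite scE.
apply/allP => y; rewrite memB => yD.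
have [Fy|//] := boolP (_ %| _); rewrite /= get //; last exact: xeB.
apply/eqP/(IHp (y + e * D.+1) j pj jc' (xeB y yD)); rewrite scE //.
by apply: all_p; apply/in_dom_decode.
Qed.

End Program.

(** The code [c] also bounds the quantifier depth of its formula. All digits of the
    environment 0 vanish, that is, the free variables are zero. *)
Definition decide (c : nat) : nat := formula_value c 0 c c.

Lemma decideP (R : realType) p : sentence p ->
  true_in (complex_structure R) p <-> decide (code p) = 1.
Proof.
move=> sp; rewrite /decide formula_valueP ?subnn //; last exact: qdepth_code.
exact: complex_board.
Qed.

(** * The decision procedure is recursive *)

Lemma prf_level N j : prf N -> prf j -> prf (fun v => level (N v) (j v)).
Proof.
move=> rN rj; apply: (@prf_ext (fun v => nat_rect (fun=> nat) (N v)
    (fun _ r => r.+1 ^ r.+2) (j v))).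
  by move=> v; rewrite /level; elim: (j v) => //= n ->.
by apply: prf_nat_rect; auto with prf.
Qed.
#[local] Hint Resolve prf_level : prf.

Lemma prf_root_order a : prf a -> prf (fun v => root_order (a v)).
Proof. by rewrite /root_order /modulus; auto 7 with prf. Qed.
#[local] Hint Resolve prf_root_order : prf.

Lemma prf_board_dim a : prf a -> prf (fun v => board_dim (a v)).
Proof. by rewrite /board_dim; auto with prf. Qed.
#[local] Hint Resolve prf_board_dim : prf.

Lemma prf_term_step c e t T : prf c -> prf e -> prf t -> prf T ->
  prf (fun v => term_step (c v) (e v) (t v) (T v)).
Proof.
by move=> rc re rt rT; rewrite /term_step /vmul /vinv /vomega; auto 20 with prf.
Qed.

Lemma prf_term_value c e t : prf c -> prf e -> prf t ->
  prf (fun v => term_value (c v) (e v) (t v)).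
Proof.
move=> rc re rt; apply: prf_term_step => //.
apply: (@prf_table _ _ (fun t T v => term_step (c v) (e v) t T)) => //.
  by auto with prf.
by apply: prf_term_step; [exact: (prf_drop 2 rc)|exact: (prf_drop 2 re)| |];
  auto with prf.
Qed.
#[local] Hint Resolve prf_term_value : prf.

Lemma prf_formula_step c i T : prf c -> prf i -> prf T ->
  prfb (fun v => formula_step (c v) (i v) (T v)).
Proof.
move=> rc ri rT; rewrite /formula_step /state; cbv zeta.
have rS : prf (fun v => states (c v)) by rewrite /states; auto 7 with prf.
have rs : prf (fun v => i v %% states (c v)) by auto with prf.
have re : prf (fun v => i v %% states (c v) %/ (c v).+1) by auto with prf.
have rj : prf (fun v => i v %% states (c v) %% (c v).+1) by auto with prf.
have rp : prf (fun v => i v %/ states (c v)) by auto with prf.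
apply: prfb_if; [by auto with prf|by auto with prf|].
apply: prfb_if; [by auto with prf|exact: prf_const|].
apply: prfb_if; [by auto with prf|by auto 12 with prf|].
apply: (@prfb_all (fun v => (board_dim (c v)).+1) (fun x v =>
  ~~ (root_order (c v) ^ (i v %% states (c v) %% (c v).+1).-1 %| x.-1)
  || (digit 2 (T v) (unpair2 (i v %/ states (c v)) * states (c v)
    + ((x + i v %% states (c v) %/ (c v).+1 * (board_dim (c v)).+1) * (c v).+1
       + (i v %% states (c v) %% (c v).+1).-1)) == 1))); last by auto with prf.
move: (prf_drop 2 rc) (prf_drop 2 rT) (prf_drop 2 rS) (prf_drop 2 re) (prf_drop 2 rj)
  (prf_drop 2 rp) => *.
by auto 20 with prf.
Qed.

Lemma prf_decide : prf (fun v => decide (nth 0 v 0)).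
Proof.
rewrite /decide /formula_value /course /state.
have rS : prf (fun v => states (nth 0 v 0)) by rewrite /states; auto 7 with prf.
apply: prf_bool; apply: prf_formula_step; [by auto with prf|by auto with prf|].
apply: (@prf_table (fun=> 2) _ (fun i T v => formula_step (nth 0 v 0) i T)).
- by auto with prf.
- by auto with prf.
- by apply: prf_bool; apply: prf_formula_step; auto with prf.
Qed.

Theorem complex_decidable (R : realType) : decidable_theory (complex_structure R).
Proof.
exists (fun v => decide (nth 0 v 0)); first exact: (prf_decide 1).
by move=> p; apply: decideP.
Qed.

Theorem theorem2p2 (R : realType) :
  completely_axiomatizes_mul mult_axiom (complex_structure R) /\
  admits_qe (complex_structure R) /\
  decidable_theory (complex_structure R).
Proof.
split; first exact: complex_complete.
by split; [apply: complex_qe|apply: complex_decidable].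
Qed.
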